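(* Let $F$ be a field of characteristic $2$, let $n\ge 1$ and let $\pi$ be an $n$-fold quadratic Pfister form over $F$. Let $K$ be a purely inseparable extension of $F$ of exponent $1$ (i.e. $K^2\subseteq F$), and let $L=K(\pi)$. Then $$W_q(L/F)=W_q(K/F)+W(F)\otimes\pi .$$
   Context: All fields have characteristic $2$; all forms are on finite-dimensional vector spaces; bilinear forms are symmetric and nonsingular. $[a,b]$ denotes the quadratic form $ax^2+xy+by^2$. A quadratic form $q$ is nonsingular if its polar form $B_q(x,y)=q(x+y)+q(x)+q(y)$ has zero radical. $W_q(F)$ is the Witt group of nonsingular quadratic forms over $F$ (classes up to isometry and hyperbolic planes $[0,0]$, addition induced by $\perp$). It is a module over the Witt ring $W(F)$ of nonsingular symmetric bilinear forms, where $\langle a_1,\dots,a_n\rangle_b$ denotes the diagonal bilinear form with entries $a_i\in F^*$ and $\langle a_1,\dots,a_n\rangle_b\otimes q=a_1q\perp\dots\perp a_nq$. $W(F)\otimes\pi$ is the set of all classes $\beta\otimes\pi$ with $\beta\in W(F)$. For a field extension $L/F$, $W_q(L/F)$ is the kernel of the scalar extension map $W_q(F)\to W_q(L)$. An $n$-fold quadratic Pfister form over $F$ is a form $\langle 1,a_1\rangle_b\otimes\dots\otimes\langle 1,a_{n-1}\rangle_b\otimes[1,a_n]$ with $a_1,\dots,a_{n-1}\in F^*$, $a_n\in F$ (for $n=1$: $[1,a_1]$ with $a_1\in F$). $K(\pi)$ denotes the function field of the projective quadric over $K$ given by the equation $\pi_K=0$, where $\pi_K$ is the scalar extension of $\pi$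 to $K$. (If $n=1$ and $\pi$ is hyperbolic, this quadric consists of two $K$-rational points and one sets $K(\pi)=K$; if $n=1$ and $\pi=[1,b]$ is anisotropic over $K$, then $K(\pi)=K(\wp^{-1}(b))$, where $\wp^{-1}(b)$ is a root of $X^2+X+b$.) *)

(* Defs.v *)
From HB Require Import structures.
From mathcomp Require Import all_boot all_order all_algebra.
From mathcomp Require Import boolp classical_sets.
From mathcomp Require Import mxtens mpoly ring.

Set Implicit Arguments.
Unset Strict Implicit.
Unset Printing Implicit Defensive.

Import GRing.Theory.
Local Open Scope ring_scope.
Local Open Scope quotient_scope.
Local Open Scope classical_set_scope.

(* A matrix A : 'M_n stands for the quadratic form
     x |-> \sum_(i, j) A i j * x_i * x_j   on F^n.
   A is not assumed symmetric (over a field of characteristic 2 a symmetric A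
   would only give diagonal forms); two matrices give the same form iff they
   differ by an alternating matrix, and isometry only sees the values. *)
Definition qform (F : fieldType) := {n : nat & 'M[F]_n}.
HB.instance Definition _ (F : fieldType) := Choice.on (qform F).

Definition qdim (F : fieldType) (q : qform F) : nat := tag q.
Definition qmx (F : fieldType) (q : qform F) : 'M[F]_(qdim q) := tagged q.
Definition QForm (F : fieldType) (n : nat) (A : 'M[F]_n) : qform F :=
  Tagged (fun n => 'M[F]_n) A.

Definition qval (F : fieldType) (q : qform F) (x : 'rV[F]_(qdim q)) : F :=
  (x *m qmx q *m x^T) 0 0.

(* The signs are immaterial in characteristic 2; with them W_q(F) below is a
   group over any field F. *)
Definition polar (F : fieldType) (q : qform F) (x y : 'rV[F]_(qdim q)) : F :=
  qval (x + y) - qval x - qval y.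

Definition nonsingular (F : fieldType) (q : qform F) : Prop :=
  forall x, (forall y, polar (q := q) x y = 0) -> x = 0.

Definition isometric (F : fieldType) (q r : qform F) : Prop :=
  exists f : 'rV[F]_(qdim q) -> 'rV[F]_(qdim r),
    [/\ linear f, bijective f & forall x, qval (f x) = qval x].

Definition osum (F : fieldType) (q r : qform F) : qform F :=
  QForm (block_mx (qmx q) 0 0 (qmx r)).

Definition qzero (F : fieldType) : qform F := QForm (0 : 'M[F]_0).

(* [a, b] = a x^2 + x y + b y^2 *)
Definition qbin (F : fieldType) (a b : F) : qform F :=
  QForm (block_mx (a%:M : 'M_1) 1%:M 0 (b%:M : 'M_1)).

Definition hyp (F : fieldType) (k : nat) : qform F :=
  iter k (osum (qbin 0 0)) (qzero F).

Definition hyperbolic (F : fieldType) (q : qform F) : Prop :=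
  exists k, isometric q (hyp F k).

Definition qopp (F : fieldType) (q : qform F) : qform F := QForm (- qmx q).

Definition qext (F K : fieldType) (i : {rmorphism F -> K}) (q : qform F) :
  qform K := QForm (map_mx i (qmx q)).

(* For a symmetric bilinear form with Gram matrix b,
   (b (x) q)(\sum_i e_i (x) x_i)
      = \sum_i b_ii q(x_i) + \sum_(i < j) b_ij B_q(x_i, x_j)
      = \sum_(i, j) b_ij x_i A x_j^T   where A = qmx q,
   which is the form of the Kronecker product of b and A; for b diagonal
   this is the orthogonal sum of the b_ii q. *)
Definition qtens (F : fieldType) (m : nat) (b : 'M[F]_m) (q : qform F) :
  qform F := QForm (b *t qmx q).

(* The bilinear form <1, a>_b. *)
Definition bilin1 (F : fieldType) (a : F) : 'M[F]_2 :=
  diag_mx (\row_(i < 2) (if i == 0 then 1 else a)).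

(* <1, a_1>_b (x) ... (x) <1, a_(n-1)>_b (x) [1, a_n] for s = a_1 ... a_(n-1) *)
Definition pfister (F : fieldType) (s : seq F) (a : F) : qform F :=
  foldr (fun c q => qtens (bilin1 c) q) (qbin 1 a) s.

Definition is_pfister (F : fieldType) (n : nat) (q : qform F) : Prop :=
  exists (s : seq F) (a : F),
    [/\ size s = n.-1, 0 \notin s & isometric q (pfister s a)].

Definition witt_equiv (F : fieldType) (q r : qform F) : Prop :=
  exists k l, isometric (osum q (hyp F k)) (osum r (hyp F l)).

Section Isometry.
Variable F : fieldType.
Implicit Types q r s t : qform F.

Lemma qvalE n (A : 'M[F]_n) (x : 'rV_n) :
  qval (q := QForm A) x = (x *m A *m x^T) 0 0.
Proof. by []. Qed.

Lemma polarE q x y :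
  polar (q := q) x y = (x *m (qmx q + (qmx q)^T) *m y^T) 0 0.
Proof.
have -> : (x *m (qmx q + (qmx q)^T) *m y^T) 0 0 =
    (x *m qmx q *m y^T) 0 0 + (y *m qmx q *m x^T) 0 0.
  rewrite mulmxDr mulmxDl mxE; congr (_ + _).
  have -> : x *m (qmx q)^T *m y^T = (y *m qmx q *m x^T)^T.
    by rewrite !trmx_mul trmxK mulmxA.
  by rewrite mxE.
rewrite /polar /qval !mulmxDl linearD /= !mulmxDr.
have mxD (M N : 'M[F]_1) : (M + N) 0 0 = M 0 0 + N 0 0 by rewrite mxE.
by rewrite !mxD; ring.
Qed.

Lemma nonsingularP q : nonsingular q <-> qmx q + (qmx q)^T \in unitmx.
Proof.
set B := _ + _; split=> [ns|uB x hx].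
  rewrite -row_free_unit -kermx_eq0; apply/eqP/row_matrixP => i.
  rewrite row0; apply: ns => y; rewrite polarE -/B.
  by rewrite -row_mul mulmx_ker row0 mul0mx mxE.
suff xB0 : x *m B = 0 by rewrite -[x](mulmxK uB) xB0 mul0mx.
apply/rowP => i; have := hx (delta_mx 0 i); rewrite polarE -/B trmx_delta.
by rewrite -colE !mxE.
Qed.

Lemma isometricI q r (f : 'rV_(qdim q) -> 'rV_(qdim r)) g :
  linear f -> cancel f g -> cancel g f ->
  (forall x, qval (f x) = qval x) -> isometric q r.
Proof. by move=> lf fK gK h; exists f; split=> //; exists g. Qed.

Lemma isometric_refl q : isometric q q.
Proof. exact: (@isometricI q q id id). Qed.

Lemma isometric_sym q r : isometric q r -> isometric r q.
Proof.
case=> f [lf [g fK gK] h]; apply: (@isometricI r q g f) => //.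
- by move=> a u v; apply: (can_inj fK); rewrite lf !gK.
- by move=> x; rewrite -h gK.
Qed.

Lemma isometric_trans q r s :
  isometric q r -> isometric r s -> isometric q s.
Proof.
case=> f [lf bf hf] [g [lg bg hg]]; exists (g \o f); split.
- by move=> a u v /=; rewrite lf lg.
- exact: bij_comp.
- by move=> x /=; rewrite hg hf.
Qed.

Lemma qval_osum q r (x : 'rV_(qdim q + qdim r)) :
  qval (q := osum q r) x = qval (lsubmx x) + qval (rsubmx x).
Proof.
rewrite qvalE -[in LHS](hsubmxK x) mul_row_block tr_row_mx mul_row_col.
by rewrite !mulmx0 addr0 add0r mxE.
Qed.

Lemma linear_row_mx m n p (f : 'rV[F]_m -> 'rV[F]_n) (g : 'rV[F]_m -> 'rV[F]_p) :
  linear f -> linear g -> linear (fun x => row_mx (f x) (g x)).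
Proof. by move=> lf lg a u v; rewrite lf lg scale_row_mx add_row_mx. Qed.

Lemma isometric_osum q q' r r' :
  isometric q q' -> isometric r r' -> isometric (osum q r) (osum q' r').
Proof.
case=> f [lf [f' fK f'K] hf] [g [lg [g' gK g'K] hg]].
apply: (@isometricI (osum q r) (osum q' r')
  (fun x => row_mx (f (lsubmx (x : 'rV_(qdim q + qdim r)))) (g (rsubmx x)))
  (fun x => row_mx (f' (lsubmx (x : 'rV_(qdim q' + qdim r')))) (g' (rsubmx x)))).
- by apply: linear_row_mx => a u v; rewrite linearP ?lf ?lg.
- by move=> x; rewrite row_mxKl row_mxKr fK gK hsubmxK.
- by move=> x; rewrite row_mxKl row_mxKr f'K g'K hsubmxK.
- by move=> x; rewrite !qval_osum row_mxKl row_mxKr hf hg.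
Qed.

Lemma isometric_osumC q r : isometric (osum q r) (osum r q).
Proof.
apply: (@isometricI (osum q r) (osum r q)
  (fun x => row_mx (rsubmx (x : 'rV_(qdim q + qdim r))) (lsubmx x))
  (fun x => row_mx (rsubmx (x : 'rV_(qdim r + qdim q))) (lsubmx x))).
- by apply: linear_row_mx => a u v; rewrite linearP.
- by move=> x; rewrite row_mxKl row_mxKr hsubmxK.
- by move=> x; rewrite row_mxKl row_mxKr hsubmxK.
- by move=> x; rewrite !qval_osum row_mxKl row_mxKr addrC.
Qed.

Lemma isometric_osumA q r s :
  isometric (osum q (osum r s)) (osum (osum q r) s).
Proof.
apply: (@isometricI (osum q (osum r s)) (osum (osum q r) s)
  (fun x : 'rV_(qdim q + (qdim r + qdim s)) =>
     row_mx (row_mx (lsubmx x) (lsubmx (rsubmx x))) (rsubmx (rsubmx x)))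
  (fun x : 'rV_(qdim q + qdim r + qdim s) =>
     row_mx (lsubmx (lsubmx x)) (row_mx (rsubmx (lsubmx x)) (rsubmx x)))).
- by do ?apply: linear_row_mx; move=> a u v; rewrite linearP ?linearP.
- by move=> x; rewrite !(row_mxKl, row_mxKr) !hsubmxK.
- by move=> x; rewrite !(row_mxKl, row_mxKr) !hsubmxK.
- by move=> x; rewrite !qval_osum !(row_mxKl, row_mxKr) addrA.
Qed.

Lemma qval0 (x : 'rV_0) : qval (q := qzero F) x = 0.
Proof. by rewrite qvalE [x]thinmx0 !mul0mx mxE. Qed.

Lemma isometric_osum0 q : isometric (osum (qzero F) q) q.
Proof.
apply: (@isometricI (osum (qzero F) q) q
  (fun x : 'rV_(0 + qdim q) => rsubmx x) (fun x => row_mx 0 x)).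
- by move=> a u v; rewrite linearP.
- by move=> x; rewrite -[RHS](hsubmxK x) [lsubmx x]thinmx0.
- by move=> x; rewrite row_mxKr.
- by move=> x; rewrite qval_osum qval0 add0r.
Qed.

Lemma isometric_osumCA q r s :
  isometric (osum q (osum r s)) (osum r (osum q s)).
Proof.
apply: isometric_trans (isometric_osumA _ _ _) _.
apply: isometric_trans (isometric_sym (isometric_osumA _ _ _)).
exact: isometric_osum (isometric_osumC _ _) (isometric_refl _).
Qed.

Lemma isometric_osumACA q r s t :
  isometric (osum (osum q r) (osum s t)) (osum (osum q s) (osum r t)).
Proof.
apply: isometric_trans (isometric_sym (isometric_osumA _ _ _)) _.
apply: isometric_trans (isometric_osumA _ _ _).
exact: isometric_osum (isometric_refl _) (isometric_osumCA _ _ _).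
Qed.

Lemma hypD k l : isometric (hyp F (k + l)) (osum (hyp F k) (hyp F l)).
Proof.
elim: k => [|k IH] /=; first exact: isometric_sym (isometric_osum0 _).
apply: isometric_trans (isometric_osumA _ _ _).
exact: isometric_osum (isometric_refl _) IH.
Qed.

Lemma witt_equiv_isom q r : isometric q r -> witt_equiv q r.
Proof.
by move=> h; exists 0%N, 0%N; apply: isometric_osum => //; apply: isometric_refl.
Qed.

Lemma witt_equiv_refl q : witt_equiv q q.
Proof. exact/witt_equiv_isom/isometric_refl. Qed.

Lemma witt_equiv_sym q r : witt_equiv q r -> witt_equiv r q.
Proof. by case=> k [l /isometric_sym h]; exists l, k. Qed.

Lemma witt_equiv_trans q r s :
  witt_equiv q r -> witt_equiv r s -> witt_equiv q s.
Proof.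
case=> k [l h] [k' [l' h']]; exists (k + k')%N, (l' + l)%N.
apply: isometric_trans (isometric_osum (isometric_refl _) (hypD _ _)) _.
apply: isometric_trans (isometric_osumA _ _ _) _.
apply: isometric_trans (isometric_osum h (isometric_refl _)) _.
apply: isometric_trans (isometric_sym (isometric_osumA _ _ _)) _.
apply: isometric_trans (isometric_osum (isometric_refl _) (isometric_osumC _ _)) _.
apply: isometric_trans (isometric_osumA _ _ _) _.
apply: isometric_trans (isometric_osum h' (isometric_refl _)) _.
apply: isometric_trans (isometric_sym (isometric_osumA _ _ _)) _.
exact: isometric_osum (isometric_refl _) (isometric_sym (hypD _ _)).
Qed.

Lemma witt_equiv_osum q q' r r' :
  witt_equiv q q' -> witt_equiv r r' -> witt_equiv (osum q r) (osum q' r').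
Proof.
case=> k [l h] [k' [l' h']]; exists (k + k')%N, (l + l')%N.
apply: isometric_trans (isometric_osum (isometric_refl _) (hypD _ _)) _.
apply: isometric_trans (isometric_osumACA _ _ _ _) _.
apply: isometric_trans (isometric_osum h h') _.
apply: isometric_trans (isometric_osumACA _ _ _ _) _.
exact: isometric_osum (isometric_refl _) (isometric_sym (hypD _ _)).
Qed.

Lemma hyperbolic_witt q : hyperbolic q -> witt_equiv q (qzero F).
Proof.
case=> k h; exists 0%N, k.
apply: isometric_trans (isometric_osumC _ _) _.
by apply: isometric_osum => //; apply: isometric_refl.
Qed.

Lemma qval_lagr n (C D : 'M[F]_n) (x : 'rV_(n + n)) :
  qval (q := QForm (block_mx 0 C 0 D)) x =
  (lsubmx x *m C *m (rsubmx x)^T + rsubmx x *m D *m (rsubmx x)^T) 0 0.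
Proof.
rewrite qvalE -[in LHS](hsubmxK x) mul_row_block tr_row_mx mul_row_col.
by rewrite !mulmx0 addr0 mul0mx add0r mulmxDl.
Qed.

Lemma hyperbolic_std n :
  hyperbolic (QForm (block_mx 0 (1%:M : 'M[F]_n) 0 0)).
Proof.
exists n; elim: n => [|n IH] /=.
  apply: (@isometricI _ _ (fun=> 0) (fun=> 0)).
  - by move=> a u v; rewrite scaler0 addr0.
  - by move=> x; rewrite [RHS](thinmx0 (x : 'rV_0)).
  - by move=> x; rewrite [RHS](thinmx0 (x : 'rV_0)).
  - by move=> x; rewrite qval0 qvalE [x](thinmx0 (x : 'rV_0)) !mul0mx mxE.
apply: isometric_trans (isometric_osum (isometric_refl _) IH).
apply: (@isometricI (QForm (block_mx 0 (1%:M : 'M[F]_(1 + n)) 0 0))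
  (osum (qbin 0 0)
                         (QForm (block_mx 0 (1%:M : 'M[F]_n) 0 0)))
  (fun x : 'rV_((1 + n) + (1 + n)) =>
     row_mx (row_mx (lsubmx (lsubmx x)) (lsubmx (rsubmx x)))
            (row_mx (rsubmx (lsubmx x)) (rsubmx (rsubmx x))))
  (fun x : 'rV_((1 + 1) + (n + n)) =>
     row_mx (row_mx (lsubmx (lsubmx x)) (lsubmx (rsubmx x)))
            (row_mx (rsubmx (lsubmx x)) (rsubmx (rsubmx x))))).
- by do ?apply: linear_row_mx; move=> a u v; rewrite linearP ?linearP.
- by move=> x; rewrite !(row_mxKl, row_mxKr) !hsubmxK.
- by move=> x; rewrite !(row_mxKl, row_mxKr) !hsubmxK.
move=> x; rewrite qval_osum !(row_mxKl, row_mxKr) /qbin !raddf0.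
rewrite !qval_lagr !(row_mxKl, row_mxKr) !mulmx0 !mul0mx !addr0 !mulmx1.
rewrite -{3}[lsubmx x](hsubmxK (lsubmx x : 'rV_(1 + n))).
rewrite -{3}[rsubmx x](hsubmxK (rsubmx x : 'rV_(1 + n))).
by rewrite tr_row_mx mul_row_col [RHS]mxE.
Qed.

Lemma hyperbolic_lagr n (C D : 'M[F]_n) :
  C \in unitmx -> hyperbolic (QForm (block_mx 0 C 0 D)).
Proof.
move=> uC; have [k hk] := hyperbolic_std n; exists k.
apply: isometric_trans hk.
apply: (@isometricI (QForm (block_mx 0 C 0 D))
  (QForm (block_mx 0 (1%:M : 'M[F]_n) 0 0))
  (fun x : 'rV_(n + n) =>
     row_mx (lsubmx x *m C + rsubmx x *m D) (rsubmx x))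
  (fun x : 'rV_(n + n) =>
     row_mx ((lsubmx x - rsubmx x *m D) *m invmx C) (rsubmx x))).
- apply: linear_row_mx => a u v; last by rewrite linearP.
  by rewrite !linearP /= !mulmxDl -!scalemxAl scalerDr addrACA.
- by move=> x; rewrite !(row_mxKl, row_mxKr) addrK mulmxK // hsubmxK.
- by move=> x; rewrite !(row_mxKl, row_mxKr) mulmxKV // subrK hsubmxK.
move=> x; rewrite !qval_lagr !(row_mxKl, row_mxKr).
by rewrite mulmx1 mulmx0 mul0mx addr0 mulmxDl.
Qed.

Lemma hyperbolic_oppr q : nonsingular q -> hyperbolic (osum (qopp q) q).
Proof.
move/nonsingularP => uB; set A := qmx q in uB.
have [k hk] := hyperbolic_lagr A uB; exists k; apply: isometric_trans hk.
apply: (@isometricI (osum (qopp q) q) (QForm (block_mx 0 (A + A^T) 0 A))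
  (fun x : 'rV_(qdim q + qdim q) => row_mx (lsubmx x) (rsubmx x - lsubmx x))
  (fun x : 'rV_(qdim q + qdim q) => row_mx (lsubmx x) (rsubmx x + lsubmx x))).
- apply: linear_row_mx => a u v; rewrite !linearP //=.
  by rewrite scalerDr addrACA.
- by move=> x; rewrite !(row_mxKl, row_mxKr) subrK hsubmxK.
- by move=> x; rewrite !(row_mxKl, row_mxKr) addrK hsubmxK.
move=> x; rewrite qval_osum qvalE mul_row_block tr_row_mx mul_row_col.
rewrite !mulmx0 add0r mul0mx add0r mulmxDl [LHS]mxE.
set u := lsubmx x; set v := rsubmx x.
rewrite -[(u *m _ *m _) 0 0](polarE (q := q) u (v - u)).
rewrite -[((v - u) *m _ *m _) 0 0]/(qval (q := q) (v - u)) /polar addrC.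
have -> : u + (v - u) = v :> 'rV_(qdim q) by rewrite addrC subrK.
rewrite [_ + (_ - _ - _)]addrC subrK.
have -> : qval (q := qopp q) u = - qval (q := q) u.
  by rewrite qvalE mulmxN mulNmx mxE.
by rewrite addrC.
Qed.

Lemma nonsingular0 : nonsingular (qzero F).
Proof. by move=> x _; rewrite [x](thinmx0 (x : 'rV_0)). Qed.

Lemma nonsingular_osum q r :
  nonsingular q -> nonsingular r -> nonsingular (osum q r).
Proof.
move=> /nonsingularP uq /nonsingularP ur; apply/nonsingularP.
rewrite /= tr_block_mx !trmx0 add_block_mx !addr0.
by rewrite unitmxE det_ublock unitrM -!unitmxE uq.
Qed.

Lemma nonsingular_opp q : nonsingular q -> nonsingular (qopp q).
Proof.
move=> /nonsingularP uq; apply/nonsingularP.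
by rewrite /= linearN -opprD -scaleN1r unitmxZ // unitrN unitr1.
Qed.

Lemma nonsingular_tens m (b : 'M[F]_m) q :
  b^T = b -> b \in unitmx -> nonsingular q -> nonsingular (qtens b q).
Proof.
move=> sb ub /nonsingularP uq; apply/nonsingularP.
have -> : qmx (qtens b q) + (qmx (qtens b q))^T = b *t (qmx q + (qmx q)^T).
  rewrite /= trmx_tens sb; apply/matrixP=> i j.
  case: (mxtens_indexP i)=> i0 i1; case: (mxtens_indexP j)=> j0 j1.
  by rewrite mxE !tensmxE [X in _ = _ * X]mxE mulrDr.
have unit0 k (M : 'M[F]_k) : k = 0%N -> M \in unitmx.
  by move=> k0; move: M; rewrite k0 => M; rewrite unitmxE det_mx00 unitr1.
have [m0|m0] := eqVneq m 0%N; first by apply: unit0; rewrite [LHS](congr1 (muln^~ _) m0).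
have [d0|d0] := eqVneq (qdim q) 0%N; last exact: tensmx_unit.
by apply: unit0; rewrite [LHS](congr1 (muln m) d0) muln0.
Qed.

End Isometry.

Lemma nonsingular_ext (F K : fieldType) (i : {rmorphism F -> K}) (q : qform F) :
  nonsingular q -> nonsingular (qext i q).
Proof.
move=> /nonsingularP uq; apply/nonsingularP.
by rewrite /= map_trmx -map_mxD map_unitmx.
Qed.

(* Pfister forms in characteristic 2 are nonsingular, hence have a class. *)
Lemma is_pfister_nonsingular (F : fieldType) (n : nat) (q : qform F) :
  2%N \in [pchar F] -> is_pfister n q -> nonsingular q.
Proof.
move=> char2 [s [a [_ s0 [f [lf [g fK gK] h]]]]].
have ns : nonsingular (pfister s a).
  elim: s s0 {f g lf fK gK h} => [_|c s IH] /=.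
    apply/nonsingularP; rewrite /= tr_block_mx add_block_mx !tr_scalar_mx.
    rewrite -!raddfD /= !addrr_pchar2 // trmx0 addr0 add0r raddf0.
    have /mulmx1_unit[] : block_mx 0 1%:M 1%:M 0 *m block_mx 0 1%:M 1%:M 0 =
      1%:M :> 'M[F]_(1 + 1); last by [].
    by rewrite mulmx_block !mulmx1 !mul0mx !mulmx0 !addr0 !add0r -scalar_mx_block.
  rewrite inE negb_or eq_sym => /andP[c0 /IH ns].
  apply: nonsingular_tens => //; first by rewrite /bilin1 tr_diag_mx.
  rewrite unitmxE det_diag !big_ord_recl big_ord0 !mxE /= mul1r mulr1.
  by rewrite unitfE.
have lg : linear g by move=> c u v; apply: (can_inj fK); rewrite lf !gK.
move=> x hx; have fD u v : f (u + v) = f u + f v.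
  by have := lf 1 u v; rewrite !scale1r.
have f0 : f 0 = 0 by apply: (addrI (f 0)); rewrite -fD !addr0.
apply: (can_inj fK); rewrite f0; apply: ns => y.
by rewrite /polar -[y]gK -fD !h; apply: hx.
Qed.

Record nsqform (F : fieldType) :=
  NSQForm { nsval :> qform F; nsvalP : `[< nonsingular nsval >] }.
HB.instance Definition _ (F : fieldType) := [isSub for @nsval F].
HB.instance Definition _ (F : fieldType) := [Choice of nsqform F by <:].

Section NonsingularForms.
Variable F : fieldType.
Implicit Types q r : nsqform F.

Lemma nonsingular_nsval q : nonsingular q.
Proof. exact: asboolW (nsvalP q). Qed.
Arguments nonsingular_nsval : clear implicits.

Definition nszero : nsqform F := NSQForm (asboolT (@nonsingular0 F)).

Definition nssum q r : nsqform F :=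
  NSQForm (asboolT (nonsingular_osum (nonsingular_nsval q) (nonsingular_nsval r))).

Definition nsopp q : nsqform F :=
  NSQForm (asboolT (nonsingular_opp (nonsingular_nsval q))).

Definition nstens m (b : 'M[F]_m) (sb : b^T = b) (ub : b \in unitmx) q :
  nsqform F := NSQForm (asboolT (nonsingular_tens sb ub (nonsingular_nsval q))).

Definition nsext (K : fieldType) (i : {rmorphism F -> K}) q : nsqform K :=
  NSQForm (asboolT (@nonsingular_ext F K i q (nonsingular_nsval q))).

Definition witt_rel : rel (nsqform F) := fun q r => `[< witt_equiv q r >].

Lemma witt_rel_refl : reflexive witt_rel.
Proof. by move=> q; apply/asboolP; apply: witt_equiv_refl. Qed.

Lemma witt_rel_sym : ssrbool.symmetric witt_rel.
Proof. by move=> q r; apply: asbool_equiv_eq; split; apply: witt_equiv_sym. Qed.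

Lemma witt_rel_trans : transitive witt_rel.
Proof.
move=> r q s /asboolP h /asboolP h'; apply/asboolP.
exact: witt_equiv_trans h h'.
Qed.

Canonical witt_eqrel := EquivRel witt_rel witt_rel_refl witt_rel_sym witt_rel_trans.

Definition Wq := {eq_quot witt_eqrel}.
HB.instance Definition _ := Choice.on Wq.
HB.instance Definition _ := EqQuotient.on Wq.

Definition wclass q : Wq := \pi_Wq q.

Lemma wclassP q r : wclass q = wclass r <-> witt_equiv q r.
Proof. by split=> [/eqmodP/asboolP //|h]; apply/eqmodP/asboolP. Qed.

Lemma wclass_ind (P : Wq -> Prop) : (forall q, P (wclass q)) -> forall w, P w.
Proof. by move=> h w; rewrite -[w]reprK; apply: h. Qed.

Definition wq_zero : Wq := wclass nszero.
Definition wq_add (v w : Wq) : Wq := wclass (nssum (repr v) (repr w)).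
Definition wq_opp (w : Wq) : Wq := wclass (nsopp (repr w)).

Lemma witt_equiv_repr q : witt_equiv (repr (wclass q)) q.
Proof. by apply/wclassP; rewrite /wclass reprK. Qed.

Lemma wclass_add q r : wq_add (wclass q) (wclass r) = wclass (nssum q r).
Proof. by apply/wclassP/witt_equiv_osum; apply: witt_equiv_repr. Qed.

Lemma wq_addA : associative wq_add.
Proof.
elim/wclass_ind=> q; elim/wclass_ind=> r; elim/wclass_ind=> s.
by rewrite !wclass_add; apply/wclassP/witt_equiv_isom/isometric_osumA.
Qed.

Lemma wq_addC : commutative wq_add.
Proof.
elim/wclass_ind=> q; elim/wclass_ind=> r.
by rewrite !wclass_add; apply/wclassP/witt_equiv_isom/isometric_osumC.
Qed.

Lemma wq_add0 : left_id wq_zero wq_add.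
Proof.
elim/wclass_ind=> q; rewrite wclass_add.
exact/wclassP/witt_equiv_isom/isometric_osum0.
Qed.

Lemma wq_addN : left_inverse wq_zero wq_opp wq_add.
Proof.
move=> w; rewrite -{2}[w]reprK wclass_add.
exact/wclassP/hyperbolic_witt/hyperbolic_oppr/nonsingular_nsval.
Qed.

HB.instance Definition _ := GRing.isZmodule.Build Wq wq_addA wq_addC wq_add0 wq_addN.

Lemma wclassD q r : wclass (nssum q r) = wclass q + wclass r.
Proof. by rewrite -wclass_add. Qed.

Lemma wclass0 : wclass nszero = 0.
Proof. by []. Qed.

End NonsingularForms.

Section ScalarExtension.
Variables (F K : fieldType) (i : {rmorphism F -> K}).

Lemma qext_osum (q r : qform F) : qext i (osum q r) = osum (qext i q) (qext i r).
Proof. by rewrite /qext /osum /= map_block_mx !raddf0. Qed.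

Lemma qext_hyp k : qext i (hyp F k) = hyp K k.
Proof.
elim: k => [|k IH]; first by congr QForm; apply/matrixP; case.
by rewrite /= qext_osum IH /qext /qbin /= map_block_mx !map_scalar_mx !raddf0 !rmorph1.
Qed.

Lemma alternating_val n (C : 'M[F]_n) (x : 'rV[K]_n) :
  (forall u : 'rV[F]_n, (u *m C *m u^T) 0 0 = 0) ->
  (x *m map_mx i C *m x^T) 0 0 = 0.
Proof.
move=> h.
have dE (k l : 'I_n) (D : 'M[F]_n) :
    (delta_mx 0 k *m D *m (delta_mx 0 l)^T : 'M_1) 0 0 = D k l.
  by rewrite -rowE trmx_delta -colE !mxE.
have diag k : C k k = 0 by rewrite -dE h.
have skew k l : C k l = - C l k.
  apply/eqP; rewrite -addr_eq0; apply/eqP.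
  have := h (delta_mx 0 k + delta_mx 0 l).
  have mxD (M N : 'M[F]_1) : (M + N) 0 0 = M 0 0 + N 0 0 by rewrite mxE.
  by rewrite !mulmxDl linearD /= !mulmxDr !mxD !dE !diag add0r addr0.
pose U := \matrix_(k < n, l < n) (if (k < l)%N then C k l else 0).
have -> : C = U - U^T.
  apply/matrixP => k l; rewrite !mxE.
  case: (ltngtP k l) => [_|_|/val_inj ->]; rewrite ?subr0 ?sub0r //.
rewrite map_mxB mulmxBr mulmxBl.
have -> : x *m map_mx i U^T *m x^T = (x *m map_mx i U *m x^T)^T.
  by rewrite !trmx_mul trmxK mulmxA map_trmx.
move: (x *m _ *m _) => V; by rewrite !mxE subrr.
Qed.

Lemma isometric_qext (q r : qform F) :
  isometric q r -> isometric (qext i q) (qext i r).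
Proof.
case=> f [lf [g fK gK] h].
have lg : linear g by move=> a u v; apply: (can_inj fK); rewrite lf !gK.
pose fL : {linear _ -> _} := HB.pack f (GRing.isLinear.Build _ _ _ _ f lf).
pose gL : {linear _ -> _} := HB.pack g (GRing.isLinear.Build _ _ _ _ g lg).
pose P := lin1_mx fL; pose Q := lin1_mx gL.
have fP u : f u = u *m P by rewrite -[f]/(fL : _ -> _) mul_rV_lin1.
have gQ u : g u = u *m Q by rewrite -[g]/(gL : _ -> _) mul_rV_lin1.
have PQ : P *m Q = 1%:M.
  by apply/row_matrixP => k; rewrite row1 rowE mulmxA -fP -gQ fK.
have QP : Q *m P = 1%:M.
  by apply/row_matrixP => k; rewrite row1 rowE mulmxA -gQ -fP gK.
apply: (@isometricI _ (qext i q) (qext i r)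
          (fun x => x *m map_mx i P) (fun x => x *m map_mx i Q)).
- by move=> a u v; rewrite mulmxDl scalemxAl.
- by move=> x; rewrite -mulmxA -map_mxM PQ map_mx1 mulmx1.
- by move=> x; rewrite -mulmxA -map_mxM QP map_mx1 mulmx1.
move=> x; apply/eqP; rewrite -subr_eq0 !qvalE trmx_mul !mulmxA.
rewrite map_trmx -[x *m _ *m _]mulmxA -map_mxM -[x *m _ *m _]mulmxA -map_mxM.
have mxB (M N : 'M[K]_1) : M 0 0 - N 0 0 = (M - N) 0 0 by rewrite !mxE.
rewrite mxB -mulmxBl -mulmxBr -map_mxB alternating_val // => u.
have mxB' (M N : 'M[F]_1) : M 0 0 - N 0 0 = (M - N) 0 0 by rewrite !mxE.
rewrite mulmxBr mulmxBl -mxB'.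
by have := h u; rewrite fP /qval trmx_mul !mulmxA => ->; rewrite subrr.
Qed.

Lemma witt_equiv_qext (q r : qform F) :
  witt_equiv q r -> witt_equiv (qext i q) (qext i r).
Proof.
case=> k [l /isometric_qext]; rewrite !qext_osum !qext_hyp => h.
by exists k, l.
Qed.

Definition wext (w : Wq F) : Wq K := wclass (nsext i (repr w)).

Lemma wext_class (q : nsqform F) : wext (wclass q) = wclass (nsext i q).
Proof. exact/wclassP/witt_equiv_qext/witt_equiv_repr. Qed.

Lemma wext_is_nmod_morphism : nmod_morphism wext.
Proof.
split=> [|v w].
  rewrite -[X in wext X]wclass0 wext_class -wclass0; apply/wclassP.
  by rewrite /= -[qzero F]/(hyp F 0) qext_hyp; apply: witt_equiv_refl.
elim/wclass_ind: v => q; elim/wclass_ind: w => r.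
rewrite -wclassD !wext_class -wclassD; apply/wclassP.
by rewrite /= qext_osum; apply: witt_equiv_refl.
Qed.

HB.instance Definition _ :=
  GRing.isNmodMorphism.Build (Wq F) (Wq K) wext wext_is_nmod_morphism.

Definition Wq_ker : set (Wq F) := [set w | wext w = 0].

End ScalarExtension.

(* W(F) (x) p: every class of the Witt ring W(F) is the class of a symmetric
   bilinear form with invertible Gram matrix b, and acts on W_q(F) through
   b (x) _. *)
Definition W_tens (F : fieldType) (p : nsqform F) : set (Wq F) :=
  [set w | exists (m : nat) (b : 'M[F]_m) (sb : b^T = b) (ub : b \in unitmx),
    w = wclass (nstens sb ub p)].

Definition quadric_poly (K : fieldType) (q : qform K) : {mpoly K[qdim q]} :=
  \sum_(k < qdim q) \sum_(l < qdim q) qmx q k l *: ('X_k * 'X_l).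

(* j : K -> L is (K-isomorphic to) the function field of the integral
   projective quadric q = 0, i.e. the field of fractions f / g of homogeneous
   polynomials of the same degree, modulo the ideal of the quadric, with g not
   in that ideal: x is the image in P(L) of the generic point, and f / g is
   identified with f(x) / g(x). *)
Definition is_quadric_function_field (K L : fieldType) (j : {rmorphism K -> L})
    (q : qform K) : Prop :=
  exists x : 'I_(qdim q) -> L,
    (forall (d : nat) (f : {mpoly K[qdim q]}), f \is d.-homog ->
       ((map_mpoly j f).@[x] = 0 <-> exists g, f = g * quadric_poly q)) /\
    (forall y : L, exists (d : nat) (f g : {mpoly K[qdim q]}),
       [/\ f \is d.-homog, g \is d.-homog, (map_mpoly j g).@[x] != 0
         & y = (map_mpoly j f).@[x] / (map_mpoly j g).@[x]]).

(* The quadric of a hyperbolic plane is not integral (it consists of two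
   rational points); its function field is K by convention. *)
Definition is_function_field (K L : fieldType) (j : {rmorphism K -> L})
    (q : qform K) : Prop :=
  (isometric q (qbin 0 0) -> bijective j) /\
  (~ isometric q (qbin 0 0) -> is_quadric_function_field j q).

(* Main.v *)
(** The inclusion from right to left holds because an isotropic Pfister form is
    hyperbolic. For the other one, let q over F be hyperbolic over L and argue by
    induction on dim q. If q is isotropic over K, then over K it has the class of a
    smaller form over F: a sum of binary forms [[a_i, b_i]] that is isotropic over K
    is isometric over K to one over F that is already isotropic over F, since
    rescaling by x in K and shearing by an alternating matrix over K only change
    the coefficients through squares of K, which lie in F.

    If q is nonzero and anisotropic over K, let d in F be a value of q. Then [d pi] is a subform
    of q over K: write K(pi) as k(th) with k = K(t_1, ..., t_m) and
    [th^2 + th t + c = 0]. A totally isotropic subspace of half dimension of q over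
    k(th) yields, for v over K with q(v) = d, a vector u over k with [q(u) = c d]
    and [B(u, v) = t d], and a version of the Cassels-Pfister theorem with linear
    constraints turns u into a linear embedding of [d pi] defined over K. Therefore
    [q + d pi] has over K the class of a form over F of smaller dimension than q. *)
Require Import Defs.
From HB Require Import structures.
From mathcomp Require Import all_boot all_order all_algebra.
From mathcomp Require Import boolp classical_sets.
From mathcomp Require Import mxtens mpoly qfpoly ring zify.

Set Implicit Arguments.
Unset Strict Implicit.
Unset Printing Implicit Defensive.

Import GRing.Theory.
Local Open Scope ring_scope.
Local Open Scope classical_set_scope.

(** * Quadratic maps on row vectors *)

(** Splitting a plane [[1, b]] off [pi], with [pi = [1, b] + p'], gives the affine equation
    [x^2 + x t_0 + Q(t) = 0], where [Q] is the sum of [b t_0^2] and [p']. The middle term is a value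
    of the polar form. A value of [q] alone therefore cannot carry it, and this is why linear
    constraints must survive the Cassels-Pfister descent: first [B(u, v) = t_0 d], then one more for
    every basis vector already placed. The given function field consists of homogeneous fractions
    only. It is mapped into the function field [k(th)] of the affine cone, where the coordinates are
    [th] and the independent variables. The vector with value [d] is taken over F, so that
    [q + d pi] is again a form over F. The graph of the embedding is totally isotropic of dimension
    [dim pi] in it, so the new dimension is [dim q + dim pi - 2 dim pi]. Only the descent of this
    smaller form from K to F uses that squares of K lie in F. *)

Section QuadraticMap.
Variables (R : comNzRingType) (n : nat) (A : 'M[R]_n).
Implicit Types (x y z : 'rV[R]_n) (a : R).

(** [qval] and [polar] live over a field; these versions over a commutative ring also serve for the
    polynomial rings below. *)
Definition qv x : R := (x *m A *m x^T) 0 0.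
Definition bv x y : R := (x *m (A + A^T) *m y^T) 0 0.

Lemma bvE x y : bv x y = (x *m A *m y^T) 0 0 + (y *m A *m x^T) 0 0.
Proof.
rewrite /bv mulmxDr mulmxDl mxE; congr (_ + _).
have -> : x *m A^T *m y^T = (y *m A *m x^T)^T by rewrite !trmx_mul trmxK mulmxA.
by rewrite mxE.
Qed.

Lemma bvC x y : bv x y = bv y x.
Proof. by rewrite !bvE addrC. Qed.

Lemma bvDl x y z : bv (x + y) z = bv x z + bv y z.
Proof. by rewrite /bv !mulmxDl mxE. Qed.

Lemma bvZl a x y : bv (a *: x) y = a * bv x y.
Proof. by rewrite /bv -!scalemxAl mxE. Qed.

Lemma bvDr x y z : bv x (y + z) = bv x y + bv x z.
Proof. by rewrite bvC bvDl !(bvC x). Qed.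

Lemma bvZr a x y : bv x (a *: y) = a * bv x y.
Proof. by rewrite bvC bvZl bvC. Qed.

Lemma bv0l y : bv 0 y = 0.
Proof. by rewrite /bv !mul0mx mxE. Qed.

Lemma qvD x y : qv (x + y) = qv x + qv y + bv x y.
Proof.
rewrite bvE /qv !mulmxDl linearD /= !mulmxDr.
have mxD (M N : 'M[R]_1) : (M + N) 0 0 = M 0 0 + N 0 0 by rewrite mxE.
by rewrite !mxD; ring.
Qed.

Lemma qvZ a x : qv (a *: x) = a ^+ 2 * qv x.
Proof.
by rewrite /qv -!scalemxAl linearZ /= -scalemxAr !mxE mulrA expr2.
Qed.

Lemma qv0 : qv 0 = 0.
Proof. by rewrite /qv !mul0mx mxE. Qed.

Lemma bv_mul m (B : 'M[R]_(m, n)) (s : 'rV_m) y :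
  bv (s *m B) y = (s *m (B *m (A + A^T) *m y^T)) 0 0.
Proof. by rewrite /bv !mulmxA. Qed.

Lemma bvxx x : bv x x = qv x *+ 2.
Proof. by rewrite bvE mulr2n. Qed.

Lemma qv_sum x : qv x = \sum_i \sum_j A i j * (x 0 i * x 0 j).
Proof.
rewrite /qv mxE exchange_big /=; apply: eq_bigr => j _.
rewrite !mxE mulr_suml; apply: eq_bigr => i _.
by rewrite mulrCA mulrA; congr (_ * _); rewrite mulrC.
Qed.

End QuadraticMap.

Lemma qv_map (R S : comNzRingType) (f : {rmorphism R -> S}) n (A : 'M_n) x :
  qv (map_mx f A) (map_mx f x) = f (qv A x).
Proof. by rewrite /qv map_trmx -!map_mxM mxE. Qed.

Lemma bv_map (R S : comNzRingType) (f : {rmorphism R -> S}) n (A : 'M_n) x y :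
  bv (map_mx f A) (map_mx f x) (map_mx f y) = f (bv A x y).
Proof. by rewrite !bvE !map_trmx -!map_mxM !mxE rmorphD. Qed.

Lemma qv_mul (R : comNzRingType) m n (B : 'M[R]_(m, n)) (A : 'M_n) x :
  qv A (x *m B) = qv (B *m A *m B^T) x.
Proof. by rewrite /qv trmx_mul !mulmxA. Qed.

Definition anisotropic (R : comNzRingType) n (A : 'M[R]_n) :=
  forall x, qv A x = 0 -> x = 0.

Lemma fractionP (R : idomainType) (x : {fraction R}) :
  exists a d, d != 0 /\ x * tofrac d = tofrac a.
Proof.
elim/quotW: x => x; exists x.1, x.2; split; first exact: denom_ratioP.
have d0 := denom_ratioP x.
rewrite -[_ * _]/(FracField.mul _ _) !piE; apply/eqmodP => /=.
rewrite /FracField.equivf /= /FracField.mulf !numden_Ratio ?mulr1 ?oner_neq0 //.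
by rewrite mulrC.
Qed.

Lemma tofrac_inj (R : idomainType) : injective (@tofrac R).
Proof. by move=> x y /eqP; rewrite tofrac_eq => /eqP. Qed.

Lemma common_denominator (R : idomainType) m (u : 'rV[{fraction R}]_m) :
  exists g (w : 'rV[R]_m), g != 0 /\ map_mx (@tofrac _) w = tofrac g *: u.
Proof.
have /fin_all_exists[a /fin_all_exists[d hd]] j :
    exists a d, d != 0 /\ u 0 j * tofrac d = tofrac a := fractionP (u 0 j).
exists (\prod_j d j), (\row_j (a j * \prod_(l | l != j) d l)); split.
  by rewrite prodf_seq_neq0; apply/allP => j _; have [] := hd j.
apply/rowP=> j; rewrite !mxE [in RHS](bigD1 j) //=. rewrite !tofracM.
by have [_ <-] := hd j; ring.
Qed.

(** * The Cassels-Pfister theorem *)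

Lemma addvv_pchar2 (R : comNzRingType) m n (x : 'M[R]_(m, n)) :
  2%N \in [pchar R] -> x + x = 0.
Proof. by move=> c2; apply/matrixP => i j; rewrite !mxE addrr_pchar2. Qed.

Section Polynomials.
Variables (k : fieldType) (n : nat) (A : 'M[k]_n).
Implicit Types (w r : 'rV[{poly k}]_n) (u : 'rV[{fraction {poly k}}]_n).

Lemma size_qv_poly w d : (forall j, size (w 0%R j) <= d.+1)%N ->
  (size (qv (map_mx polyC A) w) <= (2 * d).+1)%N /\
  (qv (map_mx polyC A) w)`_(2 * d) = qv A (\row_j (w 0 j)`_d).
Proof.
move=> hw; rewrite qv_sum; split.
  apply: leq_trans (size_sum _ _ _) _; apply/bigmax_leqP => i _.
  apply: leq_trans (size_sum _ _ _) _; apply/bigmax_leqP => j _.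
  rewrite !mxE; have hs (a : k) (p q : {poly k}) : (size p <= d.+1 ->
      size q <= d.+1 -> size (a%:P * (p * q))%R <= (2 * d).+1)%N.
    move=> hp hq; apply: leq_trans (size_polyMleq _ _) _.
    have := size_polyMleq p q; have := size_polyC_leq1 a; lia.
  exact: hs.
rewrite coef_sum [RHS]qv_sum; apply: eq_bigr => i _; rewrite coef_sum.
apply: eq_bigr => j _; rewrite !mxE coefCM; congr (_ * _).
rewrite coefM (bigD1 (inord d)) //= inordK ?ltnS; last lia.
rewrite (_ : 2 * d - d = d)%N; last lia.
rewrite big1 ?addr0 // => l; rewrite -val_eqE /= inordK; last lia.
move=> ld; case: (ltnP l d) => h.
  by rewrite [X in _ * X]nth_default ?mulr0 //; apply: leq_trans (hw j) _; lia.
by rewrite nth_default ?mul0r //; apply: leq_trans (hw i) _; lia.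
Qed.

Hypothesis anisA : anisotropic A.

(** The coefficient of degree 2D of the value is the value of [A] at the coefficients of degree D.
    For D the top degree of [w] it is nonzero by anisotropy, so the leading terms cannot cancel. *)
Lemma anisotropic_size w d : (size (qv (map_mx polyC A) w) <= (2 * d).+1)%N ->
  forall j, (size (w 0%R j) <= d.+1)%N.
Proof.
move=> hq j; pose s := (\max_l size (w 0%R l))%N.
have hs l : (size (w 0%R l) <= s)%N by apply: (leq_bigmax l).
apply: leq_trans (hs j) _; rewrite leqNgt; apply/negP => hds.
have [D sD] : exists D, s = D.+1 by exists s.-1; lia.
have [_ hD] := size_qv_poly (d := D) (fun l => leq_trans (hs l) (eq_leq sD)).
rewrite nth_default in hD; last by apply: leq_trans hq _; lia.
have [l sl] : exists l, size (w 0 l) = s.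
  have I0 : (0 < #|'I_n|)%N by apply/card_gt0P; exists j.
  by have [l El] := eq_bigmax (fun l => size (w 0%R l)) I0; exists l; rewrite -El.
have /rowP/(_ l) := anisA (esym hD); rewrite !mxE => w0.
have : lead_coef (w 0 l) = 0 by rewrite /lead_coef sl sD.
by move/eqP; rewrite lead_coef_eq0 => /eqP wl; rewrite wl size_poly0 sD in sl.
Qed.

Lemma anisotropic_polyC : anisotropic (map_mx polyC A).
Proof.
move=> w w0; have hw : forall j, (size (w 0%R j) <= 1)%N.
  by apply: anisotropic_size; rewrite w0 size_poly0.
have [_] := size_qv_poly hw; rewrite w0 coef0 => /esym/anisA c0.
apply/rowP=> j; rewrite mxE [LHS]size1_polyC //.
by move/rowP/(_ j): c0; rewrite !mxE => ->.
Qed.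

Hypothesis char2 : 2%N \in [pchar k].

Lemma poly_pchar2 : 2%N \in [pchar {poly k}].
Proof. exact: rmorph_pchar (@polyC k) _ char2. Qed.

(* With [r] the quotient and [s] the remainder of the division of [w] by [g], one
   replaces the solution [w/g] by its reflection along [s]: as [A(s) = g g'], the
   denominator drops from [g] to [g']. The linear constraints [u G = lam] survive
   because they force [r G = lam]. *)
Lemma cassels_pfister_descent c (G : 'M[k]_(n, c)) (lam : 'rV_c) p w (g : {poly k}) :
    g != 0 -> qv (map_mx polyC A) w = g ^+ 2 * p -> w *m map_mx polyC G = g *: lam ->
  exists r, qv (map_mx polyC A) r = p /\ r *m map_mx polyC G = lam.
Proof.
move: {2}(size g).+1 (ltnSn (size g)) => N; elim: N => // N IH in w g *.
rewrite ltnS => hN g0 hw hG; set Ap := map_mx _ A.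
pose r := \row_j (w 0 j %/ g); pose s := \row_j (w 0 j %% g).
have ws : w = g *: r + s.
  by apply/rowP=> j; rewrite !mxE mulrC -divp_eq.
have hs j : (size (s 0%R j) < size g)%N by rewrite mxE ltn_modp.
have sg : (0 < size g)%N by rewrite size_poly_gt0.
have rG : r *m map_mx polyC G = lam.
  apply/rowP=> j; apply/eqP; rewrite -subr_eq0; apply/eqP.
  (* The left side is a multiple of [g]; the right side has smaller degree than [g] because [G] is
     constant. Both are zero. *)
  have : g * ((r *m map_mx polyC G) 0 j - lam 0 j) = - (s *m map_mx polyC G) 0 j.
    have : g *: (r *m map_mx polyC G - lam) = - (s *m map_mx polyC G).
      by rewrite scalerBr -hG ws mulmxDl -scalemxAl opprD addrA subrr add0r.
    by move/rowP/(_ j); rewrite !mxE.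
  move/(congr1 (size : {poly k} -> nat)); rewrite size_polyN => h.
  have : (size ((s *m map_mx polyC G) 0%R j) < size g)%N.
    rewrite mxE -(prednK sg) ltnS; apply: leq_trans (size_sum _ _ _) _.
    apply/bigmax_leqP => l _; have hl (a : k) (q : {poly k}) :
        (size q < size g -> size (q * a%:P)%R <= (size g).-1)%N.
      move=> hq; apply: leq_trans (size_polyMleq _ _) _.
      have := size_polyC_leq1 a; lia.
    by rewrite [map_mx _ _ _ _]mxE; apply/hl/hs.
  rewrite -h; have hm (q : {poly k}) : (size (g * q)%R < size g)%N -> q = 0.
    apply: contraTeq => q0; rewrite size_mul // -leqNgt; move: q0; rewrite -size_poly_gt0;
      move: (size q) (size g) => a b; lia.
  by move/hm.
have [s0|s0] := eqVneq s 0.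
  exists r; split=> //; apply: (mulfI (expf_neq0 2 g0)).
  by rewrite -hw ws s0 addr0 qvZ.
(* In characteristic 2, [s = w + g r], so [A(s) = g^2 p + g^2 A(r) + g B(w, r)]; this is the
   cofactor of [g]. *)
pose g' := g * (p + qv Ap r) + bv Ap w r.
have c2 := poly_pchar2.
have sE : s = w + g *: r by rewrite ws addrAC addvv_pchar2 // add0r.
have gg' : qv Ap s = g * g'.
  by rewrite sE qvD qvZ bvZr hw /g'; ring.
have qs : qv Ap s != 0.
  by apply: contra_neq s0 => /anisotropic_polyC.
have g'0 : g' != 0 by apply: contra_neq qs => z; rewrite gg' z mulr0.
(* The reflection of [w/g] along [s], with its denominator [g'] cleared. *)
apply: (IH ((p + qv Ap r) *: w + bv Ap w r *: r) g') => //.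
(* The entries of [s] have size at most [size g - 1], so [size (g * g') <= 2 * (size g - 2) + 1],
   which bounds [size g']. The truncated subtraction is harmless: [s != 0] forces [size g >= 2]. *)
- have [] := size_qv_poly (w := s) (d := (size g).-2).
    by move=> j; rewrite -ltnS; apply: leq_trans (hs j) _; lia.
  rewrite -/Ap gg' size_mul // => hh _.
  have sg2 : (1 < size g)%N.
    by have /rV0Pn[j sj] := s0; apply: leq_trans (hs j); rewrite ltnS size_poly_gt0.
  move: hh sg2 (size_poly_gt0 g') hN; rewrite g'0.
  by move: (size g') (size g) => a b; lia.
- have two0 : 2%:R = 0 :> {poly k} := pcharf0 c2.
  rewrite qvD !qvZ bvZl bvZr hw /g'; set b := bv _ _ _; set f := qv _ _.
  apply/eqP; rewrite -subr_eq0; apply/eqP.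
  (* The identity holds up to a multiple of 2, which is written out because [ring] works without the
     characteristic. *)
  by transitivity (2%:R * (b ^+ 2 * f - g * (p + f) * b * p)); [ring | rewrite two0 mul0r].
- by rewrite mulmxDl -!scalemxAl hG rG /g' scalerA -scalerDl; congr (_ *: _); ring.
Qed.

(** A common denominator of [u] starts the descent. The degree bound on the polynomial solution
    comes from anisotropy, not from the descent. *)
Lemma cassels_pfister c (G : 'M[k]_(n, c)) (lam : 'rV_c) p u d :
    qv (map_mx (@tofrac _ \o polyC) A) u = tofrac p ->
    u *m map_mx (@tofrac _ \o polyC) G = map_mx (@tofrac _) lam ->
    (size p <= (2 * d).+1)%N ->
  exists r, [/\ qv (map_mx polyC A) r = p, r *m map_mx polyC G = lam
              & forall j, (size (r 0%R j) <= d.+1)%N].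
Proof.
move=> hu hG sp; have [g [w [g0 wE]]] := common_denominator u.
have tinj := @tofrac_inj {poly k}.
have [||r [hr rG]] := @cassels_pfister_descent c G lam p w g g0.
- apply: tinj; rewrite -qv_map wE -map_mx_comp qvZ hu rmorphM rmorphXn //.
- have: map_mx (@tofrac _) (w *m map_mx polyC G) = map_mx (@tofrac _) (g *: lam).
    by rewrite map_mxM wE -map_mx_comp -scalemxAl hG map_mxZ.
  by move=> h; apply/rowP=> j; move/rowP/(_ j): h; rewrite ![map_mx _ _ _ _]mxE => /tinj.
exists r; split=> //; apply: anisotropic_size; rewrite hr //.
Qed.

Lemma anisotropic_frac : anisotropic (map_mx (@tofrac _ \o polyC) A).
Proof.
move=> u u0; have [g [w [g0 wE]]] := common_denominator u.
have : map_mx (@tofrac _) w = 0.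
  rewrite (_ : w = 0) ?map_mx0 //; apply: anisotropic_polyC.
  apply: (@tofrac_inj {poly k}).
  by rewrite -qv_map wE -map_mx_comp qvZ u0 mulr0 rmorph0.
by rewrite wE => /eqP; rewrite scaler_eq0 tofrac_eq0 (negPf g0) => /eqP.
Qed.

End Polynomials.

(** * Subforms from generic values *)

(* [rat K m] is K(t_(m-1), ..., t_0), the last adjoined variable being the
   entry of index 0 of [gens K m]. *)
Fixpoint rat (K : fieldType) m : fieldType :=
  if m is m'.+1 then {fraction {poly (rat K m')}} : fieldType else K.

Fixpoint ratC (K : fieldType) m : {rmorphism K -> rat K m} :=
  if m is m'.+1 return {rmorphism K -> rat K m}
  then (@tofrac _ \o polyC) \o ratC K m' else idfun.

Fixpoint gens (K : fieldType) m : 'rV[rat K m]_m :=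
  if m is m'.+1 return 'rV[rat K m]_m
  then row_mx (const_mx (tofrac 'X) : 'M_1) (map_mx (@tofrac _ \o polyC) (gens K m')) else 0.

Section GenericSubform.
Variables (K : fieldType) (n : nat) (A : 'M[K]_n).
Hypothesis anisA : anisotropic A.
Hypothesis char2 : 2%N \in [pchar K].

Lemma rat_pchar2 m : 2%N \in [pchar (rat K m)].
Proof. exact: rmorph_pchar (ratC K m) _ char2. Qed.

Lemma map_ratCS m p q (B : 'M[K]_(p, q)) :
  map_mx (ratC K m.+1) B = map_mx (@tofrac _ \o polyC) (map_mx (ratC K m) B).
Proof. by rewrite -map_mx_comp. Qed.

Lemma anisotropic_rat m : anisotropic (map_mx (ratC K m) A).
Proof.
elim: m => [|m IH]; first by rewrite (_ : map_mx _ A = A) //; apply/matrixP => i j; rewrite !mxE.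
by rewrite map_ratCS; apply: anisotropic_frac.
Qed.

(** With degree bound 0 the Cassels-Pfister theorem returns a constant vector, so one variable is
    removed at each level of the tower. *)
Lemma constant_descent m c (G : 'M_(n, c)) (al : K) (be : 'rV_c) u :
    qv (map_mx (ratC K m) A) u = ratC K m al ->
    u *m map_mx (ratC K m) G = map_mx (ratC K m) be ->
  exists x, qv A x = al /\ x *m G = be.
Proof.
elim: m u => [|m IH] u; rewrite ?map_ratCS.
  have id p q (B : 'M[K]_(p, q)) : map_mx (ratC K 0) B = B.
    by apply/matrixP => i j; rewrite !mxE.
  by rewrite !id; exists u.
move=> hu hG; have [||r [hr rG sr]] := cassels_pfister (anisotropic_rat (m := m))
  (rat_pchar2 m) (G := map_mx (ratC K m) G) (p := (ratC K m al)%:P)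
   (lam := map_mx polyC (map_mx (ratC K m) be)) (d := 0) hu.
- by rewrite hG -!map_mx_comp.
- by rewrite size_polyC_leq1.
have [r0 rE] : exists r0, r = map_mx polyC r0.
  by exists (\row_j (r 0 j)`_0); apply/rowP => j; rewrite !mxE; apply: size1_polyC.
apply: (IH r0); first by apply: polyC_inj; rewrite -qv_map -rE.
move: rG; rewrite rE -map_mxM => h; apply/rowP => j; move/rowP/(_ j): h.
by rewrite ![map_mx polyC _ _ _]mxE => /polyC_inj.
Qed.

Lemma affine_poly_coefs (k : fieldType) (c : nat) (B : 'M[k]_c) (u0 u1 : 'rV_c) :
  qv (map_mx polyC B) ('X *: map_mx polyC u1 + map_mx polyC u0) =
    'X ^+ 2 * (qv B u1)%:P + 'X * (bv B u1 u0)%:P + (qv B u0)%:P.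
Proof. by rewrite qvD qvZ bvZl bv_map !qv_map addrAC. Qed.

Lemma quadratic_poly_inj (k : fieldType) (a b c a' b' c' : k) :
  'X ^+ 2 * a%:P + 'X * b%:P + c%:P = 'X ^+ 2 * a'%:P + 'X * b'%:P + c'%:P ->
  [/\ a = a', b = b' & c = c'].
Proof.
move=> /polyP h; have := (h 0, h 1, h 2)%N.
by rewrite !coefE /= !(mul0r, mul1r, addr0, add0r) => -[[-> ->] ->].
Qed.

Lemma affine_vector_inj (k : fieldType) (c : nat) (a0 a1 b0 b1 : 'rV[k]_c) :
  'X *: map_mx polyC a1 + map_mx polyC a0 = 'X *: map_mx polyC b1 + map_mx polyC b0 ->
  a1 = b1 /\ a0 = b0.
Proof.
move=> /rowP h; split; apply/rowP=> j; have /polyP := h j; rewrite !mxE => hj.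
  by have := hj 1%N; rewrite !coefE /= !(mul0r, mul1r, addr0, add0r).
by have := hj 0%N; rewrite !coefE /= !(mul0r, mul1r, addr0, add0r).
Qed.

End GenericSubform.

Lemma addrr_eq (R : comNzRingType) : 2%N \in [pchar R] -> forall x y : R, x + y + y = x.
Proof. by move=> c2 x y; rewrite -addrA addrr_pchar2 ?addr0. Qed.

(** The reflection along [z = u1 + v] exchanges [u1] and [v], since [A(z) = B(u1, v)]; [w] is the
    image of [u0]. It is kept in the form [u0 + a z] so that linear constraints vanishing on [z]
    pass from [u0] to [w]. For [z = 0] nothing has to be moved. *)
Lemma reflection (k : fieldType) n (A : 'M[k]_n) (u0 u1 v : 'rV_n) :
    2%N \in [pchar k] -> anisotropic A -> qv A u1 = qv A v ->
  exists a, let w := u0 + a *: (u1 + v) in qv A w = qv A u0 /\ bv A w v = bv A u0 u1.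
Proof.
move=> c2 anisA e; set z := u1 + v.
have bvv (x : 'rV_n) : bv A x x = 0 by rewrite bvxx mulr2n addrr_pchar2.
have [z0|z0] := eqVneq z 0.
  exists 0; rewrite scale0r addr0; split=> //; congr (bv _ _ _).
  by apply/esym; rewrite -[u1]addr0 -(addvv_pchar2 v c2) addrA -/z z0 add0r.
have qz : qv A z != 0 by apply: contra_neq z0 => /anisA.
have bz : bv A z v = qv A z by rewrite bvDl bvv addr0 qvD e addrr_pchar2 // add0r.
exists (bv A u0 z / qv A z); split.
  rewrite qvD qvZ bvZr expr2 -[_ * _ * qv A z]mulrA divfK //.
  by rewrite [_ * bv A u0 z]mulrC addrr_eq.
by rewrite bvDl bvZl bz divfK // bvDr addrCA addrr_pchar2 // addr0.
Qed.

Lemma row0_mul (R : comNzRingType) m1 m2 p (y : 'M[R]_(1, m2)) (L : 'M_(m1 + m2, p)) :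
  row_mx 0 y *m L = y *m dsubmx L.
Proof. by rewrite -[in LHS](vsubmxK L) mul_row_col mul0mx add0r. Qed.

Lemma qv_row0 (R : comNzRingType) m1 m2 (Q : 'M[R]_(m1 + m2)) (y : 'rV_m2) :
  qv Q (row_mx 0 y) = qv (drsubmx Q) y.
Proof.
by rewrite /qv -[in LHS](submxK Q) mul_row_block tr_row_mx mul_row_col trmx0 mulmx0
  !mul0mx !add0r.
Qed.

(* Induction on the number of variables: the Cassels-Pfister theorem makes [u] affine
   in the last variable, [u = u0 + t u1]; a reflection carries [u1] to a vector [v]
   over K, and the values of the polar form at [v] are recorded as one more linear
   constraint on [u0]. *)
Lemma generic_subform (K : fieldType) n (A : 'M[K]_n) m c (Q : 'M_m) (G : 'M_(n, c))
    (Lam : 'M_(m, c)) (u : 'rV[rat K m]_n) :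
    2%N \in [pchar K] -> anisotropic A ->
    qv (map_mx (ratC K m) A) u = qv (map_mx (ratC K m) Q) (gens K m) ->
    u *m map_mx (ratC K m) G = gens K m *m map_mx (ratC K m) Lam ->
  exists P : 'M_(m, n), P *m G = Lam /\ forall s, qv A (s *m P) = qv Q s.
Proof.
move=> c2 anisA; elim: m c Q G Lam u => [|m IH] c Q G Lam u hu hG.
  exists 0; split=> [|s]; first by rewrite [LHS]flatmx0 [RHS]flatmx0.
  by rewrite [s]thinmx0 mul0mx !qv0.
have anisR := anisotropic_rat anisA (m := m); have c2R := rat_pchar2 c2 m.
pose gp : 'rV[{poly rat K m}]_(1 + m) := row_mx (const_mx 'X) (map_mx polyC (gens K m)).
have gpE : gens K m.+1 = map_mx (@tofrac _) gp.
  by rewrite map_row_mx map_const_mx -map_mx_comp.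
rewrite !map_ratCS gpE in hu hG.
have mapc p q (B : 'M[rat K m]_(p, q)) :
    map_mx (@tofrac _ \o polyC) B = map_mx (@tofrac _) (map_mx polyC B).
  by rewrite -map_mx_comp.
rewrite (mapc _ _ (map_mx _ Q)) (qv_map (@tofrac _)) in hu.
rewrite (mapc _ _ (map_mx _ Lam)) -map_mxM in hG.
(* The generic value of [Q] has degree at most 2 in the last variable, so the solution has degree at
   most 1. *)
have [|r [hr rG sr]] := cassels_pfister anisR c2R (d := 1) hu hG.
  have [|//] := @size_qv_poly _ _ (map_mx (ratC K m) Q) gp 1.
  move=> j; rewrite /gp mxE; case: split => l; rewrite !mxE ?size_polyX //.
  by apply: leq_trans (size_polyC_leq1 _) _.
have [u0 [u1 rE]] : exists u0 u1, r = 'X *: map_mx polyC u1 + map_mx polyC u0.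
  exists (\row_j (r 0 j)`_0), (\row_j (r 0 j)`_1); apply/rowP=> j; rewrite !mxE.
  apply/polyP=> [[|[|i]]]; rewrite !coefE /= ?(mul0r, mul1r, addr0, add0r) //.
  by rewrite nth_default //; apply: leq_trans (sr j) _.
pose e0 : 'rV[K]_(1 + m) := row_mx (const_mx 1) 0.
pose g0 : 'rV[rat K m]_(1 + m) := row_mx 0 (gens K m).
have gE : gp = 'X *: map_mx polyC (map_mx (ratC K m) e0) + map_mx polyC g0.
  rewrite !map_row_mx !map_const_mx !rmorph1 !raddf0 scale_row_mx scaler0 add_row_mx.
  by rewrite addr0 add0r scalemx_const mulr1.
rewrite rE gE in hr rG; rewrite !affine_poly_coefs in hr.
have [h2 h1 h0] := quadratic_poly_inj hr.
have [G1 G0] : u1 *m map_mx (ratC K m) G = map_mx (ratC K m) (e0 *m Lam) /\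
    u0 *m map_mx (ratC K m) G = g0 *m map_mx (ratC K m) Lam.
  by apply: affine_vector_inj; rewrite !map_mxM !scalemxAl -!mulmxDl rG.
rewrite qv_map in h2.
(* [u1] still involves the other variables, but its value [Q(e0)] and its constraints [e0 Lam] are
   constant, so some [v] over K shares them. *)
have [v [hv vG]] := constant_descent anisA c2 h2 G1.
have [a [ha hb]] := reflection u0 c2R anisR
  (etrans h2 (esym (etrans (qv_map _ _ _) (congr1 _ hv)))).
(* The new column evaluates [B(., v)], which on the remaining vectors must agree with the polar form
   of [Q] against [e0]. *)
pose G' := row_mx G ((A + A^T) *m v^T).
pose S := Q + Q^T.
pose Lam' : 'M_(m, c + 1) := row_mx (dsubmx (Lam : 'M_(1 + m, c))) (dsubmx (S *m e0^T : 'M_(1 +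
  m, 1))).
pose Q' := drsubmx (Q : 'M_(1 + m)).
set w := u0 + _ in ha hb.
have zG : (u1 + map_mx (ratC K m) v) *m map_mx (ratC K m) G = 0.
  by rewrite mulmxDl G1 -map_mxM vG addvv_pchar2.
have bvS (k : fieldType) (f : {rmorphism K -> k}) (y : 'rV[k]_m) :
    bv (map_mx f Q) (map_mx f e0) (row_mx 0 y : 'rV_(1 + m)) =
    (y *m map_mx f (dsubmx (S *m e0^T : 'M_(1 + m, 1)))) 0 0.
  rewrite map_dsubmx -(@row0_mul _ 1 m) bvC /bv -mulmxA; congr ((_ *m _) 0 0).
  by rewrite !map_trmx -map_mxD -map_mxM.
have qvR (k : fieldType) (f : {rmorphism K -> k}) (y : 'rV[k]_m) :
    qv (map_mx f Q) (row_mx 0 y : 'rV_(1 + m)) = qv (map_mx f Q') y.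
  by rewrite map_drsubmx; apply: (@qv_row0 _ 1 m).
have [||P' [PG hP]] := IH _ Q' G' Lam' w.
- by rewrite ha h0; apply: etrans (qvR _ _ _) _.
- rewrite map_row_mx mul_mx_row [X in row_mx X _]mulmxDl -scalemxAl zG scaler0 addr0 G0.
  rewrite map_row_mx mul_mx_row (@row0_mul _ 1 m) map_dsubmx; congr row_mx.
  apply/matrixP=> i j; rewrite !ord1 -bvS -h1 bvC -hb /bv; congr (_ 0 0).
  by rewrite map_mxM mulmxA map_mxD -!map_trmx.
have [PG1 PG2] := eq_row_mx (etrans (esym (mul_mx_row _ _ _)) PG).
exists (col_mx v P' : 'M_(1 + m, n)); split.
  rewrite (@mul_col_mx _ 1 m) vG PG1 -[RHS](@vsubmxK _ 1 m); congr (@col_mx _ 1 m c _ _).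
  rewrite -[in LHS](@vsubmxK _ 1 m _ Lam) (@mul_row_col _ 1 1 m) mul0mx addr0 (_ : const_mx 1 =
    1%:M) ?mul1mx //.
  by apply/matrixP=> i j; rewrite !ord1 !mxE.
move=> s; rewrite -[s](@hsubmxK _ _ 1 m) (@mul_row_col _ 1 1 m).
set s' := rsubmx _; rewrite [lsubmx _]mx11_scalar mul_scalar_mx; set b := lsubmx _ 0 0.
have -> : row_mx b%:M s' = b *: e0 + row_mx 0 s' :> 'rV_(1 + m).
  rewrite scale_row_mx scaler0 add_row_mx add0r addr0 scalemx_const mulr1; congr row_mx.
  by apply/matrixP=> i j; rewrite !ord1 !mxE.
rewrite !qvD !qvZ !bvZl hv hP (@qv_row0 _ 1 m); congr (_ + _ + _ * _).
have id p q (B : 'M[K]_(p, q)) : map_mx (idfun : {rmorphism K -> K}) B = B.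
  by apply/matrixP => i j; rewrite !mxE.
by have := bvS K idfun s'; rewrite !id -PG2 => ->; rewrite [LHS]bvC bv_mul !mulmxA.
Qed.

(** * The generic point of a quadric *)

Lemma quadratic_extension (k : fieldType) (b c : k) :
    (forall x, x ^+ 2 + x * b + c != 0) ->
  exists (E : fieldType) (f : {rmorphism k -> E}) (th : E),
    th ^+ 2 + th * f b + f c = 0 /\ forall y, exists u v, y = f u + f v * th.
Proof.
move=> noroot; pose h : {poly k} := 'X^2 + ('X * b%:P + c%:P).
have sr : (size ('X * b%:P + c%:P)%R < size ('X^2 : {poly k})%R)%N.
  rewrite size_polyXn ltnS; apply: leq_trans (size_polyD _ _) _.
  rewrite geq_max (leq_trans (size_polyC_leq1 _)) // andbT.
  by apply: leq_trans (size_polyMleq _ _) _; rewrite size_polyX; have := size_polyC_leq1 b; lia.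
have sh : size h = 3 by rewrite size_polyDl // size_polyXn.
have hm : h \is monic by rewrite monicE lead_coefDl // lead_coefXn.
have hirr : irreducible_poly h.
  apply: cubic_irreducible; first by rewrite sh.
  by move=> x; apply/negP => /rootP; rewrite /h !hornerE => h0;
    by have /eqP[] := noroot x; rewrite -h0.
have hI : monic_irreducible_poly h by split.
have hE : mk_monic h = h by rewrite /mk_monic sh hm.
pose E : fieldType := {poly %/ h with hI}.
pose q : {poly k} -> {poly %/ h} := in_qpoly h.
have qC a : q a%:P = qpolyC h a.
  apply: val_inj; apply: in_qpoly_small; rewrite hE sh.
  by apply: leq_ltn_trans (size_polyC_leq1 _) _.
have qrel : q 'X ^+ 2 + q 'X * qpolyC h b + qpolyC h c = 0.
  rewrite -!qC -[q 'X ^+ 2]/(q 'X * q 'X) -!in_qpolyM -!in_qpolyD -addrA -expr2 -/h.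
  apply: val_inj; by rewrite /= hE Pdiv.RingMonic.rmodpp.
exists E, (qpolyC h : {rmorphism k -> {poly %/ h}}), (q 'X); split=> // y.
exists ((y : {poly %/ h}) : {poly k})`_0, ((y : {poly %/ h}) : {poly k})`_1.
set y0 := _`_0; set y1 := _`_1.
suff -> : y = q (y0%:P + y1%:P * 'X).
  by rewrite /q in_qpolyD in_qpolyM -/q !qC.
apply: val_inj; rewrite /q; set z := _ + _.
have zE : z = (y : {poly %/ h}) :> {poly k}.
  apply/polyP=> i; rewrite /z coefD coefC coefCM coefX.
  case: i => [|[|i]]; rewrite /= ?(mulr0, mulr1, addr0, add0r) // nth_default //.
  have h3 : size (mk_monic h) = 3 by rewrite hE.
  by rewrite -ltnS; apply: leq_trans (size_mk_monic _) _; rewrite h3.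
by rewrite [RHS]in_qpoly_small zE // size_mk_monic.
Qed.

(* [c = a t^2 + c'] with [c'] free of the variable t: a root x is integral over
   k[t], hence a polynomial, and its coefficients of degree <= 2 force [c' = 0]. *)
Lemma fraction_root (k : fieldType) (a c : k) (x : {fraction {poly k}}) :
    2%N \in [pchar k] ->
    x ^+ 2 + x * tofrac 'X + tofrac ('X ^+ 2 * a%:P + c%:P) = 0 ->
  c = 0 /\ exists s, s ^+ 2 + s + a = 0.
Proof.
move=> c2 hx; have [n [d [d0 xE]]] := fractionP x.
pose g := gcdp n d; pose n1 := n %/ g; pose d1 := d %/ g.
have g0 : g != 0 by rewrite gcdp_eq0 negb_and d0 orbT.
have nE : n = n1 * g by rewrite divpK // dvdp_gcdl.
have dE : d = d1 * g by rewrite divpK // dvdp_gcdr.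
have cop : coprimep n1 d1 by apply: coprimep_div_gcd; rewrite d0 orbT.
have d10 : d1 != 0 by apply: contra_neq d0 => z; rewrite dE z mul0r.
have x1 : x * tofrac d1 = tofrac n1.
  have tg : tofrac g != 0 by rewrite tofrac_eq0.
  by apply: (mulIf tg); rewrite -mulrA -!tofracM -nE -dE.
have rel : n1 ^+ 2 + d1 * (n1 * 'X + d1 * ('X ^+ 2 * a%:P + c%:P)) = 0.
  apply: tofrac_inj; rewrite tofrac0; move: (_ + c%:P) hx => e hx.
  rewrite !(tofracD, tofracM, tofracXn) -x1 -[RHS](mulr0 (tofrac d1 ^+ 2)) -hx.
  by ring.
have dn : d1 %| n1 ^+ 2.
  by move/eqP: rel; rewrite addr_eq0 => /eqP ->; rewrite dvdpNr dvdp_mulr.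
have /eqP sd : size d1 == 1.
  by rewrite -coprimepp; apply: coprimep_dvdr dn _; apply: coprimep_expl.
have [e dC] : exists e, d1 = e%:P by exists d1`_0; apply: size1_polyC; rewrite sd.
have e0 : e != 0 by apply: contra_neq d10 => z; rewrite dC z.
pose r := n1 * (e^-1)%:P.
have nr : n1 = r * d1 by rewrite /r dC -mulrA -polyCM mulVf // mulr1.
have rr : r ^+ 2 + r * 'X + 'X ^+ 2 * a%:P + c%:P = 0.
  apply: (mulfI (expf_neq0 2 d10)); rewrite mulr0 -rel nr; ring.
clearbody r; have co i : (r ^+ 2)`_i + (r * 'X)`_i + ('X ^+ 2 * a%:P)`_i + (c%:P)`_i = 0.
  by rewrite -!coefD rr coef0.
have := (co 0, co 1, co 2)%N.
rewrite !(coefMX, coefMC, coefXn, coefC) /= expr2 !coefM !big_ord_recr !big_ord0 /=.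
rewrite !(mul0r, mul1r, addr0, add0r) subn0 => -[[h0 h1] h2].
(* The coefficient of degree 1 of [r^2] is zero in characteristic 2, which leaves [r_0 = 0]. Degree
   0 then gives [c = 0], and degree 2 the relation for [r_1]. *)
have r0 : r`_0 = 0.
  by move: h1; rewrite [r`_1 * _]mulrC addrr_pchar2 ?add0r //.
move: h0 h2; rewrite r0 !(mul0r, mulr0, addr0, add0r) => -> h2; split=> //.
by exists r`_1; rewrite expr2.
Qed.

Lemma qv_block_diag (R : comNzRingType) m1 m2 (A : 'M[R]_m1) (D : 'M_m2) x y :
  qv (block_mx A 0 0 D) (row_mx x y) = qv A x + qv D y.
Proof. by rewrite /qv mul_row_block !mulmx0 addr0 add0r tr_row_mx mul_row_col mxE. Qed.

Lemma qv_scalar1 (R : comNzRingType) (a : R) (x : 'rV_1) : qv a%:M x = x 0 0 ^+ 2 * a.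
Proof. by rewrite /qv !mxE big_ord1 !mxE big_ord1 mxE eqxx mulr1n; ring. Qed.

(** Separating the last variable, a root would make [Q] vanish at the generic point and give a root
    of [s^2 + s + a] over [rat K m]. The first is impossible for m > 0, the second for m = 0, where
    [rat K 0] is K. *)
Lemma quadric_no_root (K : fieldType) m (a : K) (Q : 'M_m) (x : rat K m.+1) :
    2%N \in [pchar K] -> (m = 0%N -> forall s : K, s ^+ 2 + s + a != 0) ->
    ((0 < m)%N -> exists s, qv Q s != 0) ->
  x ^+ 2 + x * gens K m.+1 0 0 +
    qv (map_mx (ratC K m.+1) (block_mx a%:M 0 0 Q : 'M_(1 + m))) (gens K m.+1) != 0.
Proof.
move=> c2 ha hQ; apply/negP => /eqP.
have -> : gens K m.+1 0 0 = tofrac 'X.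
  by rewrite /= mxE; case: splitP => // j _; rewrite mxE.
rewrite map_block_mx !raddf0 map_scalar_mx map_ratCS.
have -> : qv (block_mx (ratC K m.+1 a)%:M 0 0 (map_mx (@tofrac _ \o polyC) (map_mx (ratC K m) Q)))
    (gens K m.+1 : 'rV_(1 + m)) = tofrac ('X ^+ 2 * (ratC K m a)%:P + (qv (map_mx (ratC K m) Q)
      (gens K m))%:P).
  rewrite [LHS](@qv_block_diag _ 1 m) qv_scalar1 !mxE (qv_map (@tofrac _ \o polyC)) /=.
  by rewrite !(tofracD, tofracM, tofracXn).
move=> /(fraction_root (rat_pchar2 c2 m)) [cz [s hs]].
have [m0|m0] := posnP m.
  by subst m; have /eqP := ha erefl s.
have [s' /eqP[]] := hQ m0.
(* If [Q] vanishes at the generic point, its generic value is represented by the form on the zero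
   space; [Q] then factors through that form and is zero. *)
have [|||P [_ hP]] := @generic_subform K 0 0 m 0 Q 0 0 0 c2.
- by move=> y _; apply/rowP; case.
- by rewrite cz qv0.
- by apply/rowP; case.
by rewrite -hP [_ *m _]thinmx0 qv0.
Qed.

(** * Totally isotropic subspaces over a quadratic extension *)

Lemma quadratic_free (k E : fieldType) (f : {rmorphism k -> E}) (th : E) (b c : k) :
    (forall x, x ^+ 2 + x * b + c != 0) -> th ^+ 2 + th * f b + f c = 0 ->
  forall u v, f u + f v * th = 0 -> u = 0 /\ v = 0.
Proof.
move=> noroot hth u v.
have [->|v0] := eqVneq v 0.
  by rewrite rmorph0 mul0r addr0 => /eqP; rewrite fmorph_eq0 => /eqP.
move=> h; have tE : th = f (- u / v).
  rewrite fmorph_div rmorphN; apply: (mulIf (x := f v)); first by rewrite fmorph_eq0.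
  by rewrite divfK ?fmorph_eq0 // mulrC; apply/eqP; rewrite -addr_eq0 addrC h.
have /eqP[] := noroot (- u / v); move: (- u / v) tE => x tE; apply: (fmorph_inj f).
by rewrite !rmorphD rmorphXn rmorphM -tE hth rmorph0.
Qed.

(* As A is anisotropic over k, the k-space of all [u + th v] in the row space of W
   projects bijectively onto the second component [v]. *)
Lemma lagrangian_pair (k E : fieldType) (f : {rmorphism k -> E}) (th : E) (b c : k)
    n l (A : 'M[k]_n) (W : 'M[E]_(l, n)) :
    2%N \in [pchar k] -> (forall x, x ^+ 2 + x * b + c != 0) ->
    th ^+ 2 + th * f b + f c = 0 -> (forall y, exists u v, y = f u + f v * th) ->
    anisotropic A -> (n <= 2 * \rank W)%N -> (forall s, qv (map_mx f A) (s *m W) = 0) ->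
  forall v, exists u, qv A u = c * qv A v /\ bv A u v = b * qv A v.
Proof.
move=> c2 noroot hth gen anisA rW isoW.
have c2E : 2%N \in [pchar E] := rmorph_pchar f c2.
have free := quadratic_free noroot hth.
have th2 : th ^+ 2 = th * f b + f c.
  by rewrite -[LHS]addr0 -(addrr_pchar2 c2E (th * f b + f c)) addrA [X in X + _]addrA hth add0r.
pose W' := row_base W; pose r := \rank W.
have isoW' s : qv (map_mx f A) (s *m W') = 0.
  have /submxP[D ->] : (s *m W' <= W)%MS by rewrite (submx_trans (submxMl _ _)) ?eq_row_base.
  exact: isoW.
have freeW : row_free W' := row_base_free W.
clearbody W'; have [W0 [W1 WE]] : exists W0 W1 : 'M[k]_(r, n), W' = map_mx f W0 + th *: map_mx f W1.
  have /fin_all_exists[g0 /fin_all_exists[g1 hg]] (ij : 'I_r * 'I_n) :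
    exists u v, W' ij.1 ij.2 = f u + f v * th := gen _.
  exists (\matrix_(i, j) g0 (i, j)), (\matrix_(i, j) g1 (i, j)).
  by apply/matrixP=> i j; have /= -> := hg (i, j); rewrite !mxE mulrC.
(* Over k the row space of [W'] is spanned by the rows of [W0 + th W1] and of
   [th (W0 + th W1) = c W1 + th (W0 + b W1)]; [X] and [Y] are the components on 1 and [th]. *)
pose X := col_mx W0 (c *: W1); pose Y := col_mx W1 (W0 + b *: W1).
have key s1 s2 : map_mx f (row_mx s1 s2 *m X) + th *: map_mx f (row_mx s1 s2 *m Y) =
   (map_mx f s1 + th *: map_mx f s2) *m W' :> 'rV_n.
  rewrite !mul_row_col WE !(map_mxD, map_mxM, map_mxZ) !(mulmxDl, mulmxDr) -!scalemxAl -!scalemxAr.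
  rewrite !scalerDr !scalerA -expr2 th2 scalerDl.
  by rewrite -!addrA; congr (_ + _); rewrite [LHS]addrC -!addrA.
(* The expansion of [A(u + th v) = 0] with [th^2 = b th + c]; by freeness of 1 and [th] each bracket
   vanishes. *)
have isoXY (s : 'rV[k]_(r + r)) : f (qv A (s *m X) + c * qv A (s *m Y)) +
    f (bv A (s *m X) (s *m Y) + b * qv A (s *m Y)) * th = 0.
  have := isoW' (map_mx f (lsubmx s) + th *: map_mx f (rsubmx s)).
  rewrite -key hsubmxK qvD qvZ bvZr bv_map !qv_map th2 => <-.
  by rewrite !(rmorphD, rmorphM); ring.
have freeY (s : 'rV[k]_(r + r)) : s *m Y = 0 -> s = 0.
  move=> sY; have [+ _] := free _ _ (isoXY s); rewrite sY qv0 mulr0 addr0 => /anisA sX.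
  have := key (lsubmx s) (rsubmx s); rewrite hsubmxK sX sY !map_mx0 scaler0 addr0 => /esym.
  rewrite -[RHS](mul0mx _ W') => /(row_free_inj freeW) h.
  have h' (j : 'I_r) : lsubmx s 0 j = 0 /\ rsubmx s 0 j = 0.
    by apply: free; move/rowP/(_ j): h; rewrite ![in LHS]mxE mulrC !mxE.
  have sl : lsubmx s = 0 by apply/rowP=> j; have [-> _] := h' j; rewrite mxE.
  have sr : rsubmx s = 0 by apply/rowP=> j; have [_ ->] := h' j; rewrite mxE.
  by rewrite -(hsubmxK s) sl sr row_mx0.
have rY : row_free Y.
  rewrite -kermx_eq0; apply/eqP/row_matrixP=> i; rewrite row0; apply: freeY.
  by rewrite -row_mul mulmx_ker row0.
have fY : row_full Y by rewrite /row_full eqn_leq rank_leq_col (eqP rY) addnn -mul2n.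
move=> v; pose s := v *m pinvmx Y.
have sY : s *m Y = v by rewrite mulmxKpV // submx_full.
have [/eqP + /eqP] := free _ _ (isoXY s).
by rewrite sY !addr_eq0 !(oppr_pchar2 c2) => /eqP h1 /eqP h2; exists (s *m X).
Qed.

(** For [d = A(v)] the vector [u] has value [d Q(t)] and [B(u, v) = d t_0], both generic in [t]. The
    second condition is passed on as a single linear constraint, and it produces the mixed term
    [x s_0] of the quadric. *)
Lemma generic_quadric_subform (K E : fieldType) n (A : 'M[K]_n) m (Q : 'M[K]_m.+1)
    (f : {rmorphism rat K m.+1 -> E}) (th : E) l (W : 'M[E]_(l, n)) :
    let t := gens K m.+1 0 0 in let c := qv (map_mx (ratC K m.+1) Q) (gens K m.+1) in
    2%N \in [pchar K] -> (forall x, x ^+ 2 + x * t + c != 0) ->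
    th ^+ 2 + th * f t + f c = 0 -> (forall y, exists u v, y = f u + f v * th) ->
    anisotropic A -> (n <= 2 * \rank W)%N ->
    (forall s, qv (map_mx (f \o ratC K m.+1) A) (s *m W) = 0) ->
  forall v, exists P : 'M_(m.+1, n), forall x s,
    qv A (x *: v + s *m P) = qv A v * (x ^+ 2 + x * s 0 0 + qv Q s).
Proof.
move=> t c c2 noroot hth gen anisA rW isoW v.
have c2R := rat_pchar2 c2 m.+1.
have [|u [hu hb]] := lagrangian_pair c2R noroot hth gen (anisotropic_rat anisA (m := m.+1)) rW _
  (map_mx (ratC K m.+1) v).
  by move=> s; rewrite -map_mx_comp; apply: isoW.
pose G : 'cV_n := (A + A^T) *m v^T.
pose Lam : 'M[K]_(m.+1, 1) := qv A v *: delta_mx 0 0.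
have [||P [PG hP]] := @generic_subform K n A m.+1 1 (qv A v *: Q) G Lam u c2 anisA.
- rewrite hu qv_map mulrC /c map_mxZ /qv -scalemxAr -scalemxAl [RHS]mxE //.
- apply/matrixP=> i j; rewrite !ord1 map_mxM mulmxA map_mxD -!map_trmx.
  rewrite -[LHS]/(bv (map_mx (ratC K m.+1) A) u (map_mx (ratC K m.+1) v)) hb qv_map.
  by rewrite map_mxZ map_delta_mx -scalemxAr -colE [RHS]mxE [X in _ = _ * X]mxE mulrC.
exists P => x s; rewrite qvD qvZ bvZl hP bvC bv_mul.
have -> : (s *m (P *m (A + A^T) *m v^T)) 0 0 = qv A v * s 0 0.
  by rewrite -[P *m _ *m _]mulmxA PG -scalemxAr -colE !mxE.
have -> : qv (qv A v *: Q) s = qv A v * qv Q s.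
  by rewrite /qv -scalemxAr -scalemxAl mxE.
by ring.
Qed.

Arguments ratC : simpl never.
Arguments gens : simpl never.

(** * Polynomials at the generic point and maps out of the function field *)

Lemma mpoly_ring_ind n (R : comNzRingType) (P : {mpoly R[n]} -> Prop) :
    (forall c, P c%:MP) -> (forall i, P 'X_i) ->
    (forall p q, P p -> P q -> P (p + q)) -> (forall p q, P p -> P q -> P (p * q)) ->
  forall p, P p.
Proof.
move=> hC hX hD hM p; rewrite (mpolyE p).
apply: (big_ind P) => // [|m _]; first by rewrite -mpolyC0; apply: hC.
rewrite -mul_mpolyC; apply: (hM); first exact: hC.
rewrite mpolyXE_id; apply: (big_ind P) => // [|i _].
  by rewrite -mpolyC1; apply: hC.
by elim: (m i) => [|k IH]; rewrite ?expr0 ?exprS -?mpolyC1; [apply: hC | apply: hM].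
Qed.

Lemma mpoly_morph_eq n (R S : comNzRingType) (g h : {rmorphism {mpoly R[n]} -> S}) :
  (forall c, g c%:MP = h c%:MP) -> (forall i, g 'X_i = h 'X_i) -> g =1 h.
Proof.
move=> hC hX; elim/mpoly_ring_ind => // p q ep eq; first by rewrite !rmorphD ep eq.
by rewrite !rmorphM ep eq.
Qed.

Lemma mmapXi n (R S : comNzRingType) (f : {rmorphism R -> S}) v i :
  mmap f v ('X_i : {mpoly R[n]}) = v i.
Proof. by rewrite mmapX mmap1U. Qed.

Lemma meval_map_mpoly n (R S : comNzRingType) (f : {rmorphism R -> S}) v (p : {mpoly R[n]}) :
  (map_mpoly f p).@[v] = mmap f v p.
Proof.
apply: (mpoly_morph_eq (g := meval v \o map_mpoly f) (h := mmap f v)) => [c|i] /=.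
  by rewrite map_mpolyC mevalC mmapC.
by rewrite map_mpolyX mevalXU mmapXi.
Qed.

(** Algebraic independence of the variables. A polynomial is read as one in [X_0] over the
    polynomials in the others, renamed by [sh]; its value is a univariate polynomial whose
    coefficients fall under the induction hypothesis. *)
Lemma gens_free (K : fieldType) m (p : {mpoly K[m]}) :
  mmap (ratC K m) (fun i => gens K m 0 i) p = 0 -> p = 0.
Proof.
elim: m p => [|m IH] p.
  have [c ->] : exists c, p = c%:MP.
    elim/mpoly_ring_ind: p => [c|[]//|p q [c ->] [d ->]|p q [c ->] [d ->]].
    - by exists c.
    - by exists (c + d); rewrite mpolyCD.
    - by exists (c * d); rewrite mpolyCM.
  by rewrite mmapC /= => ->; rewrite mpolyC0.
pose sh := mmap (@mpolyC m.+1 K) (fun i : 'I_m => 'X_(lift ord0 i)) : {mpoly K[m]} -> {mpoly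
  K[m.+1]}.
have [P ->] : exists P, p = (map_poly sh P).['X_ord0].
  elim/mpoly_ring_ind: p => [c|i|p q [P ->] [Q ->]|p q [P ->] [Q ->]].
  - by exists (c%:MP)%:P; rewrite map_polyC hornerC /= /sh mmapC.
  - case: (unliftP ord0 i) => [j ->|->]; last by exists 'X; rewrite map_polyX hornerX.
    by exists ('X_j)%:P; rewrite map_polyC hornerC /= /sh mmapXi.
  - by exists (P + Q); rewrite rmorphD hornerD.
  - by exists (P * Q); rewrite rmorphM hornerM.
have mm (g : 'I_m.+1) : mmap (ratC K m.+1) (fun i => gens K m.+1 0 i) ('X_g) = gens K m.+1 0 g.
  exact: mmapXi.
set ev := mmap (ratC K m.+1) _ in mm *; set ev' := mmap (ratC K m) (fun i => gens K m 0 i) in IH.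
have evsh q : ev (sh q) = tofrac (ev' q)%:P.
  apply: (mpoly_morph_eq (g := ev \o sh) (h := (@tofrac _ \o polyC) \o ev')) => [c|i] /=.
    by rewrite /sh /ev /ev' !mmapC.
  rewrite !mmapXi.
  rewrite (_ : lift ord0 i = rshift 1 i); last exact: val_inj.
  by rewrite [LHS](@row_mxEr _ 1 1 m) mxE.
have g0 : gens K m.+1 0 ord0 = tofrac 'X.
  by rewrite (_ : ord0 = lshift m (0 : 'I_1)) ?(@row_mxEl _ 1 1 m) ?mxE //; apply: val_inj.
have -> (Q : {poly {mpoly K[m.+1]}}) x : ev Q.[x] = (map_poly ev Q).[ev x].
  exact: esym (horner_map (mmap (ratC K m.+1) (fun i => gens K m.+1 0 i)) _ _).
rewrite mm g0 -map_poly_comp.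
rewrite (eq_map_poly (g := (@tofrac _ \o polyC) \o ev')) => [|q]; last exact: evsh.
rewrite map_poly_comp (map_poly_comp (@tofrac _) polyC) horner_map -/(comp_poly 'X _) comp_polyXr.
rewrite -(tofrac0 {poly rat K m}) => /tofrac_inj/polyP P0.
suff -> : P = 0 by rewrite map_poly0 horner0.
apply/polyP=> i; have := P0 i; rewrite coef_map_id0 ?coef0; first exact: IH.
by rewrite /ev' mmap0.
Qed.

(** The map sends [f(x)/g(x)] to [f(y)/g(y)]. It is well defined because a homogeneous polynomial
    vanishes at [x] exactly when it vanishes at [y], namely when the quadric divides it. *)
Lemma function_field_hom (K L E : fieldType) (j : {rmorphism K -> L}) (j' : {rmorphism K -> E})
    (q : qform K) (x : 'I_(qdim q) -> L) (y : 'I_(qdim q) -> E) :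
    (forall (d : nat) (f : {mpoly K[qdim q]}), f \is d.-homog ->
       ((map_mpoly j f).@[x] = 0 <-> exists g, f = g * quadric_poly q)) ->
    (forall z : L, exists (d : nat) (f g : {mpoly K[qdim q]}),
       [/\ f \is d.-homog, g \is d.-homog, (map_mpoly j g).@[x] != 0
         & z = (map_mpoly j f).@[x] / (map_mpoly j g).@[x]]) ->
    mmap j' y (quadric_poly q) = 0 ->
    (forall f, mmap j' y f = 0 -> exists g, f = g * quadric_poly q) ->
  exists h : {rmorphism L -> E}, forall c, h (j c) = j' c.
Proof.
move=> genx surj y0 geny; pose ex := mmap j x; pose ey := mmap j' y.
have {}genx d f : f \is d.-homog -> (ex f = 0 <-> ey f = 0).
  move=> hf; rewrite /ex -meval_map_mpoly (genx _ _ hf); split=> [[g ->]|]; last exact: geny.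
  by rewrite /ey rmorphM /= y0 mulr0.
have ne d g : g \is d.-homog -> ex g != 0 -> ey g != 0.
  by move=> hg; apply: contra_neq => /(genx _ _ hg).
have {}surj z : exists d f g, [/\ f \is d.-homog, g \is d.-homog, ex g != 0 & z = ex f / ex g].
  by have [d [f [g]]] := surj z; rewrite !meval_map_mpoly => h; exists d, f, g.
(* The value at [z] is computed from some fraction representing [z]; [hE] shows that every other
   fraction gives the same value. *)
have [h hh] := choice (fun z => let: ex_intro d (ex_intro f (ex_intro g hfg)) := surj z in
   ex_intro (fun w => exists d f g, [/\ f \is d.-homog, g \is d.-homog, ex g != 0, z = ex f / ex g
      & w = ey f / ey g]) (ey f / ey g) (ex_intro _ d (ex_intro _ f (ex_intro _ g
        (let: And4 a b c e := hfg in And5 a b c e erefl))))).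
have hE d f g : f \is d.-homog -> g \is d.-homog -> ex g != 0 -> h (ex f / ex g) = ey f / ey g.
  move=> hf hg g0; have [d' [f' [g' [hf' hg' g'0 e ->]]]] := hh (ex f / ex g).
  apply/eqP; rewrite eqr_div ?(ne _ _ hg) ?(ne _ _ hg') //.
  rewrite /ey -!rmorphM -subr_eq0 -rmorphB /=; apply/eqP.
  (* Both fractions have degree 0, so the cross difference is homogeneous and the comparison of [x]
     with [y] applies to it. *)
  have hd : f' * g - f * g' \is (d' + d).-homog.
    by apply: rpredB; [apply: dhomogM | rewrite addnC; apply: dhomogM].
  apply/(genx _ _ hd); rewrite /ex rmorphB !rmorphM; apply/eqP; rewrite subr_eq0.
  by rewrite -eqr_div //; apply/eqP; apply: esym e.
have hadd : zmod_morphism h.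
  move=> a b; have [d [f [g [hf hg g0 ->]]]] := surj a;
    have [d' [f' [g' [hf' hg' g'0 ->]]]] := surj b.
  rewrite (hE _ _ _ hf hg g0) (hE _ _ _ hf' hg' g'0).
  rewrite -!mulNr !addf_div ?(ne _ _ hg) ?(ne _ _ hg') //.
  have e (S : fieldType) (p : {rmorphism {mpoly K[qdim q]} -> S}) :
     (p f * p g' + - p f' * p g) / (p g * p g') = p (f * g' - f' * g) / p (g * g').
    by rewrite rmorphB !rmorphM mulNr.
  rewrite /ex /ey !e -/ex -/ey; apply: (hE (d + d')%N).
  - by apply: rpredB; [apply: dhomogM | rewrite addnC; apply: dhomogM].
  - exact: dhomogM.
  - by rewrite /ex rmorphM mulf_neq0.
have hmul : monoid_morphism h.
  split.
    have e1 (S : fieldType) (p : {rmorphism {mpoly K[qdim q]} -> S}) : 1 = p 1 / p 1.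
      by rewrite rmorph1 divr1.
    rewrite [X in h X](e1 _ (mmap j x)) [RHS](e1 _ (mmap j' y)).
    by apply: (hE 0); rewrite ?dhomog1 // /ex rmorph1 oner_neq0.
  move=> a b; have [d [f [g [hf hg g0 ->]]]] := surj a;
    have [d' [f' [g' [hf' hg' g'0 ->]]]] := surj b.
  rewrite (hE _ _ _ hf hg g0) (hE _ _ _ hf' hg' g'0) !mulf_div /ex /ey -!rmorphM.
  by apply: (hE (d + d')%N); [apply: dhomogM.. | rewrite /ex rmorphM mulf_neq0].
pose hr : {rmorphism L -> E} := HB.pack h (GRing.isZmodMorphism.Build _ _ h hadd)
  (GRing.isMonoidMorphism.Build _ _ h hmul).
exists hr => c; have e1 (S : fieldType) (p : {rmorphism K -> S}) v : p c = mmap p v (c%:MP :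
  {mpoly K[qdim q]}) / mmap p v (1 : {mpoly K[qdim q]}).
  by rewrite mmapC rmorph1 divr1.
rewrite [RHS](e1 _ _ y) [X in hr X](e1 _ _ x); apply: (hE 0).
- by rewrite -[c%:MP]mulr1 mul_mpolyC; apply/dhomogZ/dhomog1.
- exact: dhomog1.
- by rewrite /ex rmorph1 oner_neq0.
Qed.

(** The values at basis vectors and at their pairwise sums determine the form as a polynomial.
    Writing the difference as [U - U^T] makes the identity stable under any change of rings. *)
Lemma qv_eq_alternating (R : comNzRingType) n (B D : 'M[R]_n) :
  (forall x, qv B x = qv D x) -> exists U, B = D + (U - U^T).
Proof.
move=> h; pose C := B - D.
have hC x : qv C x = 0 by rewrite /qv mulmxBr mulmxBl [LHS]mxE [X in _ + X]mxE -!/(qv _ _) h subrr.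
have CE : B = D + C by rewrite addrC subrK.
clearbody C; have dE k l (M : 'M[R]_n) : (delta_mx 0 k *m M *m (delta_mx 0 l)^T : 'M_1) 0 0 = M k l.
  by rewrite -rowE trmx_delta -colE !mxE.
have diag k : C k k = 0 by rewrite -dE; apply: hC.
have skew k l : C k l = - C l k.
  apply/eqP; rewrite -addr_eq0; apply/eqP.
  have := hC (delta_mx 0 k + delta_mx 0 l).
  by rewrite qvD !hC bvE !dE !add0r.
pose U := \matrix_(k < n, l < n) (if (k < l)%N then C k l else 0).
exists U; rewrite CE; congr (_ + _); apply/matrixP => k l; rewrite !mxE.
by case: (ltngtP k l) => [_|_|/val_inj ->]; rewrite ?subr0 ?sub0r ?diag.
Qed.

Lemma qv_alternating (R : comNzRingType) n (U : 'M[R]_n) x : qv (U - U^T) x = 0.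
Proof.
rewrite /qv mulmxBr mulmxBl.
have -> : x *m U^T *m x^T = (x *m U *m x^T)^T by rewrite !trmx_mul trmxK mulmxA.
by rewrite !mxE subrr.
Qed.

Lemma qvDm (R : comNzRingType) n (A B : 'M[R]_n) x : qv (A + B) x = qv A x + qv B x.
Proof. by rewrite /qv mulmxDr mulmxDl mxE. Qed.

Lemma qv_eq_map (R S : comNzRingType) (g : {rmorphism R -> S}) n (B D : 'M[R]_n) :
  (forall x, qv B x = qv D x) -> forall x, qv (map_mx g B) x = qv (map_mx g D) x.
Proof.
move=> /qv_eq_alternating[U ->] x.
by rewrite map_mxD qvDm map_mxB -map_trmx qv_alternating addr0.
Qed.

(** The form [x^2 + x s_0 + Q(s)]: the shape of [[1, b] + p'] once [b] and [p'] are gathered in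
    [Q]. *)
Definition quadric_mx (R : comNzRingType) m (Q : 'M[R]_m.+1) : 'M[R]_(1 + m.+1) :=
  block_mx 1%:M (delta_mx 0 0) 0 Q.

Lemma qv_block_upper (R : comNzRingType) m1 m2 (A : 'M[R]_m1) B (D : 'M_m2) x y :
  qv (block_mx A B 0 D) (row_mx x y) = qv A x + (x *m B *m y^T) 0 0 + qv D y.
Proof.
rewrite /qv mul_row_block !mulmx0 addr0 tr_row_mx mul_row_col [LHS]mxE mulmxDl -addrA.
by congr (_ + _); rewrite mxE.
Qed.

Lemma qv_quadric_mx (R : comNzRingType) m (Q : 'M[R]_m.+1) (a : R) s :
  qv (quadric_mx Q) (row_mx a%:M s) = a ^+ 2 + a * s 0 0 + qv Q s.
Proof.
rewrite qv_block_upper qv_scalar1 mulr1 [a%:M 0 0]mxE eqxx mulr1n; congr (_ + _ + _).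
by rewrite mul_scalar_mx -scalemxAl -rowE !mxE.
Qed.

Lemma quadric_poly_qv (K : fieldType) (q : qform K) :
  quadric_poly q = qv (map_mx (@mpolyC _ _) (qmx q)) (\row_i 'X_i).
Proof.
rewrite qv_sum; apply: eq_bigr => k _; apply: eq_bigr => l _.
by rewrite !mxE mul_mpolyC.
Qed.

(** * The ideal of the generic point of a quadric *)

Section GenericPoint.
Variables (K E : fieldType) (m : nat) (Q : 'M[K]_m.+1) (q : qform K).
Variables (S : 'M[K]_(qdim q, 1 + m.+1)) (T : 'M[K]_(1 + m.+1, qdim q)).
Variables (f : {rmorphism rat K m.+1 -> E}) (th : E).
Let t := gens K m.+1 0 0.
Let c := qv (map_mx (ratC K m.+1) Q) (gens K m.+1).
Hypothesis ST : S *m T = 1%:M.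
Hypothesis TS : T *m S = 1%:M.
Hypothesis qT : forall z, qv (qmx q) (z *m T) = qv (quadric_mx Q) z.
Hypothesis noroot : forall x, x ^+ 2 + x * t + c != 0.
Hypothesis hth : th ^+ 2 + th * f t + f c = 0.

Let j' : {rmorphism K -> E} := f \o ratC K m.+1.
(** [z] is the generic point in the coordinates of the normal form and [y] the same point in those
    of [q]. Dually, the entries of [l] are the normal form coordinates as linear forms in the
    variables of [q], and [sub] substitutes all of them but the first. *)
Let z : 'rV[E]_(1 + m.+1) := row_mx th%:M (map_mx f (gens K m.+1)).
Let y i := (z *m map_mx j' T) 0 i.
Let R := {mpoly K[qdim q]}.
Let C : {rmorphism K -> R} := @mpolyC _ _.
Let l : 'rV[R]_(1 + m.+1) := (\row_i 'X_i) *m map_mx C S.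
Let l0 := l 0 (lshift m.+1 0).
Let l' i := l 0 (rshift 1 i).
Let sub (A : {mpoly K[m.+1]}) : R := mmap C l' A.

Lemma qT_map (R' : comNzRingType) (g : {rmorphism K -> R'}) x :
  qv (map_mx g (qmx q)) (x *m map_mx g T) = qv (quadric_mx (map_mx g Q)) x.
Proof.
rewrite qv_mul map_trmx -!map_mxM.
have := qv_eq_map g (B := T *m qmx q *m T^T) (D := quadric_mx Q).
rewrite map_block_mx map_mx1 raddf0 map_delta_mx => -> // s.
by rewrite -qv_mul qT.
Qed.

Lemma quadric_normal_form :
  exists Qp, quadric_poly q = l0 ^+ 2 + l0 * l' 0 + sub Qp /\
    mmap (ratC K m.+1) (fun i => gens K m.+1 0 i) Qp = c.
Proof.
have mE (S' : comNzRingType) (g : {rmorphism K -> S'}) v :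
    mmap g v (qv (map_mx (@mpolyC _ _) Q) (\row_i 'X_i)) = qv (map_mx g Q) (\row_i v i).
  rewrite -(qv_map (mmap g v)) -map_mx_comp.
  rewrite (_ : map_mx (mmap g v) _ = \row_i v i); last by apply/rowP=> i; rewrite !mxE mmapXi.
  by rewrite (_ : map_mx (_ \o _) Q = map_mx g Q) //; apply/matrixP=> i k; rewrite !mxE /= mmapC.
exists (qv (map_mx (@mpolyC _ _) Q) (\row_i 'X_i)); split.
  rewrite /sub mE quadric_poly_qv -[X in qv _ X]mulmx1 -(map_mx1 C) -ST map_mxM mulmxA qT_map -/l.
  rewrite (_ : \row_i l' i = rsubmx l); last by apply/rowP=> i; rewrite [LHS]mxE [RHS]mxE.
  rewrite -[in LHS](hsubmxK l) [lsubmx l]mx11_scalar qv_quadric_mx.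
  by rewrite [lsubmx _ _ _]mxE [rsubmx l 0 0]mxE.
by rewrite mE; congr (qv _ _); apply/rowP=> i; rewrite mxE.
Qed.

(** Division by the quadric, which is monic of degree 2 in [l0]. The polynomials of the required
    shape contain the constants and the linear forms [l], and they are closed under products because
    [l0^2] can be eliminated. *)
Lemma quadric_decomposition (p : R) :
  exists h A B, p = h * quadric_poly q + sub A * l0 + sub B.
Proof.
have [Qp [qE _]] := quadric_normal_form.
have subD a b : sub (a + b) = sub a + sub b by rewrite /sub rmorphD.
have subM a b : sub (a * b) = sub a * sub b by rewrite /sub rmorphM.
have subN a : sub (- a) = - sub a by rewrite /sub rmorphN.
have subC a : sub a%:MP = a%:MP by rewrite /sub mmapC.
have subX i : sub 'X_i = l' i by rewrite /sub mmapXi.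
have sub0 : sub 0 = 0 by rewrite /sub rmorph0.
have sub1 : sub 1 = 1 by rewrite /sub rmorph1.
pose Pr (p : R) := exists h A B, p = h * quadric_poly q + sub A * l0 + sub B.
have PD p1 p2 : Pr p1 -> Pr p2 -> Pr (p1 + p2).
  move=> [h1 [A1 [B1 ->]]] [h2 [A2 [B2 ->]]]; exists (h1 + h2), (A1 + A2), (B1 + B2).
  by rewrite !subD; ring.
have PM p1 p2 : Pr p1 -> Pr p2 -> Pr (p1 * p2).
  move=> [h1 [A1 [B1 ->]]] [h2 [A2 [B2 ->]]].
  exists (h1 * (h2 * quadric_poly q + sub A2 * l0 + sub B2) + h2 * (sub A1 * l0 + sub B1)
    + sub A1 * sub A2), (A1 * B2 + A2 * B1 + - (A1 * A2 * 'X_0)), (B1 * B2 + - (A1 * A2 * Qp)).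
  rewrite !(subD, subN, subM) subX qE; ring.
have PC a : Pr a%:MP by exists 0, 0, a%:MP; rewrite sub0 !mul0r !add0r subC.
elim/mpoly_ring_ind: p => // i; rewrite -/(Pr _).
have -> : 'X_i = (l *m map_mx C T) 0 i.
  by rewrite /l -mulmxA -map_mxM ST map_mx1 mulmx1 mxE.
rewrite mxE; apply: (big_ind Pr) => // [|k _]; first by rewrite -mpolyC0.
apply: PM; last by rewrite mxE; apply: PC.
case: (splitP k) => [o ko|o ko].
  have -> : k = lshift m.+1 0 by apply: val_inj; rewrite /= ko ord1.
  by exists 0, 1, 0; rewrite sub0 sub1 mul0r mul1r add0r addr0.
have -> : k = rshift 1 o by apply: val_inj.
by exists 0, 0, 'X_o; rewrite sub0 !mul0r !add0r subX.
Qed.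

Lemma eval_l k : mmap j' y (l 0 k) = z 0 k.
Proof.
suff /rowP/(_ k) : map_mx (mmap j' y) l = z by rewrite [LHS]mxE.
rewrite /l map_mxM -map_mx_comp.
rewrite (_ : map_mx (mmap j' y) (\row_i 'X_i) = z *m map_mx j' T); last first.
  by apply/rowP=> i; rewrite [LHS]mxE [X in mmap _ _ X]mxE mmapXi.
have -> : map_mx (mmap j' y \o C) S = map_mx j' S.
  by apply/matrixP=> i k'; rewrite !mxE /= mmapC.
by rewrite -mulmxA -map_mxM TS map_mx1 mulmx1.
Qed.

Lemma eval_sub A : mmap j' y (sub A) = f (mmap (ratC K m.+1) (fun i => gens K m.+1 0 i) A).
Proof.
apply: (mpoly_morph_eq (g := mmap j' y \o mmap C l') (h := f \o mmap (ratC K m.+1) (fun i =>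
  gens K m.+1 0 i))) => [a|i] /=.
  by rewrite !mmapC.
by rewrite !mmapXi /l' eval_l /z row_mxEr mxE.
Qed.

Lemma eval_l0 : mmap j' y l0 = th.
Proof. by rewrite /l0 eval_l /z row_mxEl mxE eqxx. Qed.

Lemma generic_point_quadric : mmap j' y (quadric_poly q) = 0.
Proof.
have [Qp [-> hQ]] := quadric_normal_form.
rewrite !rmorphD rmorphXn rmorphM /= eval_l0 eval_sub hQ /l' eval_l /z row_mxEr mxE.
exact: hth.
Qed.

(* Reduction modulo the quadric leaves [A(t) th + B(t)], and [1, th] is free over K(t). *)
Lemma generic_point_ideal p : mmap j' y p = 0 -> exists g, p = g * quadric_poly q.
Proof.
have [h [A [B ->]]] := quadric_decomposition p.
rewrite !rmorphD !rmorphM /= generic_point_quadric mulr0 add0r eval_l0 !eval_sub addrC.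
move=> /(quadratic_free noroot hth) [/gens_free -> /gens_free ->].
by exists h; rewrite /sub rmorph0 mul0r !addr0.
Qed.

End GenericPoint.

(** * Hyperbolic planes and totally isotropic subspaces *)

Section Isometries.
Variable F : fieldType.
Implicit Types q r : qform F.

Lemma qvalE_qv q x : qval (q := q) x = qv (qmx q) x.
Proof. by []. Qed.

Lemma polar_bv q x y : polar (q := q) x y = bv (qmx q) x y.
Proof. exact: polarE. Qed.

Lemma isometric_mxP q r : isometric q r <-> exists S T,
  [/\ S *m T = 1%:M, T *m S = 1%:M & forall x, qv (qmx r) (x *m S) = qv (qmx q) x].
Proof.
split=> [[f [lf [g fK gK] h]]|[S [T [ST TS h]]]]; last first.
  apply: (@isometricI F q r (fun x => x *m S) (fun x => x *m T)) => //.
  - by move=> a u v; rewrite mulmxDl scalemxAl.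
  - by move=> x; rewrite -mulmxA ST mulmx1.
  - by move=> x; rewrite -mulmxA TS mulmx1.
have lg : linear g by move=> a u v; apply: (can_inj fK); rewrite lf !gK.
pose fL : {linear _ -> _} := HB.pack f (GRing.isLinear.Build _ _ _ _ f lf).
pose gL : {linear _ -> _} := HB.pack g (GRing.isLinear.Build _ _ _ _ g lg).
have fE u : f u = u *m lin1_mx fL by rewrite mul_rV_lin1.
have gE u : g u = u *m lin1_mx gL by rewrite mul_rV_lin1.
exists (lin1_mx fL), (lin1_mx gL); split=> [||x].
- by apply/row_matrixP => k; rewrite row1 rowE mulmxA -fE -gE fK.
- by apply/row_matrixP => k; rewrite row1 rowE mulmxA -gE -fE gK.
- by rewrite -fE; apply: h.
Qed.

Lemma mx_inverse_dim m n (S : 'M[F]_(m, n)) T : S *m T = 1%:M -> T *m S = 1%:M -> m = n.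
Proof.
move=> ST TS; apply/eqP; rewrite eqn_leq -{1}(mxrank1 F m) -{2}(mxrank1 F n) -ST -TS.
by rewrite (leq_trans (mxrankM_maxr _ _)) ?rank_leq_row // (leq_trans (mxrankM_maxr _ _))
  ?rank_leq_row.
Qed.

Lemma isometric_dim q r : isometric q r -> qdim q = qdim r.
Proof. by move=> /isometric_mxP[S [T [ST TS _]]]; apply: mx_inverse_dim ST TS. Qed.

Lemma nonsingular_isometric q r : isometric q r -> nonsingular q -> nonsingular r.
Proof.
move=> /isometric_mxP[S [T [ST TS h]]] ns x hx.
have hB u v : bv (qmx r) (u *m S) (v *m S) = bv (qmx q) u v.
  by apply: (addrI (qv (qmx q) u + qv (qmx q) v));
    rewrite -[RHS]qvD -(h (u + v)) -(h u) -(h v) mulmxDl qvD.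
have : x *m T = 0.
  by apply: ns => y; rewrite polar_bv -hB -mulmxA TS mulmx1 -polar_bv hx.
by move=> xT; rewrite -[x]mulmx1 -TS mulmxA xT mul0mx.
Qed.

Lemma nonsingular_osumr q r : nonsingular (osum q r) -> nonsingular r.
Proof.
move=> ns x hx; have : row_mx (0 : 'rV_(qdim q)) x = 0.
  apply: ns => y; have [y1 [y2 ->]] : exists y1 y2, y = row_mx y1 y2 :> 'rV_(qdim q + qdim r).
    by exists (lsubmx (y : 'rV_(qdim q + qdim r))), (rsubmx (y : 'rV_(qdim q + qdim r)));
      rewrite hsubmxK.
  rewrite /polar add_row_mx !qval_osum !row_mxKl !row_mxKr !add0r.
  have := hx y2; rewrite /polar (_ : qval (0 : 'rV_(qdim q)) = 0); last exact: qv0.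
  by rewrite add0r => h0; rewrite -[RHS]h0; ring.
by rewrite -row_mx0 => /eq_row_mx[].
Qed.

Hypothesis char2 : 2%N \in [pchar F].

(** A vector [f] with [B(e, f) = 1] completes [e] to a nonsingular plane, and [q] is the sum of this
    plane and its orthogonal complement, with basis [C]. *)
Lemma split_plane q (e : 'rV_(qdim q)) : nonsingular q -> e != 0 ->
  exists b q', [/\ isometric q (osum (qbin (qv (qmx q) e) b) q'), nonsingular q'
    & qdim q = (qdim q').+2].
Proof.
move=> ns e0; set A := qmx q; set n := qdim q in A e e0 *.
have bvv (x : 'rV[F]_n) : bv A x x = 0 by rewrite bvxx mulr2n addrr_pchar2.
have [f ef] : exists f : 'rV[F]_n, bv A e f = 1.
  have [y hy] : exists y : 'rV_n, bv A e y != 0.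
    apply: contrapT => h; case/eqP: e0; apply: ns => y; rewrite polar_bv.
    by apply/eqP; apply: contrapT => /negP hy; apply: h; exists y.
  by exists ((bv A e y)^-1 *: y); rewrite bvZr mulVf.
pose B := A + A^T; pose be := B *m e^T; pose bf := B *m f^T.
have beE (x : 'rV_n) : x *m be = (bv A x e)%:M by rewrite [LHS]mx11_scalar /be mulmxA.
have bfE (x : 'rV_n) : x *m bf = (bv A x f)%:M by rewrite [LHS]mx11_scalar /bf mulmxA.
have [beB bfB] : be = B *m e^T /\ bf = B *m f^T by [].
clearbody be bf; pose M := row_mx be bf; pose C := row_base (kermx M).
have freeC : row_free C := row_base_free _.
pose P := 1%:M - bf *m e - be *m f.
have mE (x : 'rV_n) : x *m P = x - bv A x f *: e - bv A x e *: f.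
  by rewrite /P !mulmxBr mulmx1 !mulmxA beE bfE !mul_scalar_mx.
have CM : C *m M = 0.
  by apply/eqP; rewrite -sub_kermx eq_row_base.
have [Cbe Cbf] : C *m be = 0 /\ C *m bf = 0.
  by move: CM; rewrite mul_mx_row -row_mx0 => /eq_row_mx.
have PM : P *m M = 0.
  apply/row_matrixP=> i; rewrite row0 row_mul rowE mE; set x := delta_mx 0 i.
  rewrite mul_mx_row beE bfE -!scaleNr !bvDl !bvZl !bvv ef (bvC A f e) ef.
  by rewrite !(mulr0, mulr1) !addr0 !subrr raddf0 row_mx0.
have [D PE] : exists D, P = D *m C.
  by apply/submxP; rewrite eq_row_base sub_kermx PM.
(* Coordinates of [x]: [x = B(x, f) e + B(x, e) f + x P], where [P] projects onto the orthogonal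
   complement. *)
pose S := row_mx (row_mx bf be) D.
pose T := col_mx (col_mx e f) C.
have ST : S *m T = 1%:M.
  rewrite /S /T !mul_row_col -PE (_ : P = 1%:M - (bf *m e + be *m f)); last by rewrite opprD addrA.
  by rewrite addrC subrK.
have DE : D = P *m pinvmx C by rewrite PE mulmxKp.
have CP : C *m P = C by rewrite /P !mulmxBr mulmx1 !mulmxA Cbe Cbf !mul0mx !subr0.
have eD : e *m D = 0 by rewrite DE mulmxA mE ef bvv scale1r scale0r subrr subr0 mul0mx.
have fD : f *m D = 0 by rewrite DE mulmxA mE bvv bvC ef scale0r scale1r subr0 subrr mul0mx.
have TS : T *m S = 1%:M.
  rewrite /S /T mul_col_mx !mul_mx_row !mul_col_mx Cbe Cbf eD fD !beE !bfE ef (bvC A f e) ef !bvv.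
  rewrite DE mulmxA CP mulmxVp // raddf0 col_mx0 row_mx0.
  by rewrite -block_mxEh -[LHS]block_mxEv -!scalar_mx_block.
exists (qv A f), (QForm (C *m A *m C^T)).
have iso : isometric q (osum (qbin (qv A e) (qv A f)) (QForm (C *m A *m C^T))).
  apply/isometric_mxP; exists S, T; split=> // x.
  rewrite -[in RHS](mulmx1 x) -ST mulmxA.
  have -> : x *m S = row_mx (row_mx (bv A x f)%:M (bv A x e)%:M) (x *m D).
    by rewrite /S !mul_mx_row bfE beE.
  move: (bv A x f) (bv A x e) (x *m D) => a b s.
  rewrite [LHS]qv_block_diag qv_block_upper !qv_scalar1 -qv_mul.
  rewrite /T !mul_row_col !mul_scalar_mx [RHS]qvD qvD !qvZ bvZl bvZr ef mulr1.
  have hC g : C *m (B *m g^T) = 0 -> bv A (s *m C) g = 0.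
    by move=> h; rewrite bv_mul -mulmxA h mulmx0 mxE.
  rewrite bvDl !bvZl !(bvC A _ (s *m C)) !hC -?beB -?bfB // !mulr0 !addr0.
  by rewrite tr_scalar_mx -scalemxAl mul1mx !mxE !eqxx !mulr1n; congr (_ + _); ring.
split=> //; first by apply: nonsingular_osumr (nonsingular_isometric iso ns).
exact: isometric_dim iso.
Qed.
End Isometries.

Section WittIndex.
Variable F : fieldType.
Implicit Types q r : qform F.

(** A totally isotropic subspace of dimension at least [n], given by any spanning rows. With [n]
    half the dimension it expresses hyperbolicity in a form that is easy to intersect, project,
    extend and tensor, and it takes the place of Witt cancellation. *)
Definition isotropic_rank q n := exists k (W : 'M[F]_(k, qdim q)),
  (n <= \rank W)%N /\ forall s, qv (qmx q) (s *m W) = 0.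

Lemma isotropic_rank_leq q m n : (m <= n)%N -> isotropic_rank q n -> isotropic_rank q m.
Proof. by move=> mn [k [W [rW hW]]]; exists k, W; split=> //; apply: leq_trans rW. Qed.

Lemma isotropic_rank_isometric q r n : isometric q r -> isotropic_rank q n -> isotropic_rank r n.
Proof.
move=> /isometric_mxP[S [T [ST TS h]]] [k [W [rW hW]]]; exists k, (W *m S); split.
  apply: leq_trans rW _; rewrite -{1}[W]mulmx1 -ST mulmxA; exact: mxrankM_maxl.
by move=> s; rewrite mulmxA h.
Qed.

Lemma qv_qbin (a b u v : F) :
  qv (qmx (qbin a b)) (row_mx u%:M v%:M) = u ^+ 2 * a + u * v + v ^+ 2 * b.
Proof.
rewrite [LHS]qv_block_upper !qv_scalar1 mulmx1 tr_scalar_mx -scalar_mxM !mxE.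
by rewrite !eqxx !mulr1n.
Qed.

Lemma qv_plane q (a b : F) z :
  qv (qmx (osum (qbin 0 0) q)) (row_mx (row_mx a%:M b%:M) z) = a * b + qv (qmx q) z.
Proof.
rewrite [LHS]qv_block_diag qv_block_upper !qv_scalar1 !mulr0 add0r addr0 mulmx1.
by rewrite tr_scalar_mx -scalar_mxM mxE eqxx mulr1n.
Qed.

Lemma plane_vector n (x : 'rV[F]_(1 + 1 + n)) : exists a b z, x = row_mx (row_mx a%:M b%:M) z.
Proof.
exists (lsubmx (lsubmx x) 0 0), (rsubmx (lsubmx x) 0 0), (rsubmx x).
by rewrite -!mx11_scalar !hsubmxK.
Qed.

Lemma isotropic_rank_plane q n : isotropic_rank q n -> isotropic_rank (osum (qbin 0 0) q) n.+1.
Proof.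
move=> [k [W [rW hW]]].
exists (1 + k)%N, (block_mx (row_mx 1%:M 0) 0 0 W); split.
  have u0 : row_mx 1%:M 0 != 0 :> 'rV[F]_(1 + 1).
    by rewrite -row_mx0; apply/eqP => /eq_row_mx[/matrixP/(_ 0 0)/eqP]; rewrite !mxE oner_eq0.
  by rewrite rank_diag_block_mx rank_rV u0.
move=> s; rewrite -(hsubmxK s) mul_row_block !mulmx0 addr0 add0r [lsubmx _]mx11_scalar.
rewrite mul_mx_row mulmx1 mulmx0 -(raddf0 (@scalar_mx F 1)).
by rewrite [LHS]qv_plane mulr0 add0r hW.
Qed.

(** For the isotropic vector [e = (1, 0, 0)], [q] is the form on the orthogonal of [e] modulo [e].
    Here [cy] computes [B(., e)] and [pz] is the projection; the intersection and the projection
    together lose one dimension only. *)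
Lemma isotropic_rank_plane_inv q n :
  isotropic_rank (osum (qbin 0 0) q) n.+1 -> isotropic_rank q n.
Proof.
move=> [k [W [rW hW]]].
pose cy : 'M[F]_(1 + 1 + qdim q, 1) := col_mx (col_mx 0 1%:M) 0.
pose pz : 'M[F]_(1 + 1 + qdim q, _) := col_mx 0 1%:M.
have cyE a b z : row_mx (row_mx a%:M b%:M) z *m cy = b%:M.
  by rewrite !mul_row_col !mulmx0 mulmx1 add0r addr0.
have pzE a b z : row_mx (row_mx a%:M b%:M) z *m pz = z.
  by rewrite mul_row_col mulmx0 mulmx1 add0r.
have {}hW x : (x <= W)%MS -> qv (qmx (osum (qbin 0 0) q)) x = 0.
  by case/submxP=> D ->.
pose W1 := (W :&: kermx cy)%MS; pose W2 := W1 *m pz.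
have r1 := mxrank_mul_ker W cy; have r2 := mxrank_mul_ker W1 pz.
exists _, W2; split; last first.
  move=> s; rewrite mulmxA; have : (s *m W1 <= W1)%MS by apply: submxMl.
  rewrite sub_capmx sub_kermx => /andP[/hW].
  have [a [b [z ->]]] := plane_vector (s *m W1); rewrite cyE pzE => + /eqP b0.
  have -> : b = 0 by move/matrixP/(_ 0 0): b0; rewrite !mxE eqxx.
  by rewrite qv_plane mulr0 add0r.
pose u : 'rV[F]_(1 + 1 + qdim q) := row_mx (row_mx 1%:M 0) 0.
have line : (W1 :&: kermx pz <= u)%MS.
  apply/rV_subP => x; rewrite !sub_capmx !sub_kermx.
  have [a [b [z ->]]] := plane_vector x; rewrite cyE pzE => /andP[/andP[_ /eqP -> /eqP ->]].
  apply/submxP; exists a%:M; rewrite !mul_mx_row !mulmx0 mulmx1 //.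
(* If [W] is orthogonal to [e], only the projection can lose a dimension. Otherwise the intersection
   loses one and [W] contains no nonzero multiple of [e], so the projection loses none. *)
have [c0|c0] := eqVneq (\rank (W *m cy)) 0%N.
  have l1 := leq_trans (mxrankS line) (rank_leq_row u).
  rewrite c0 add0n in r1; rewrite -ltnS -[(\rank W2).+1]addn1; apply: leq_trans rW _.
  by rewrite -r1 -/W1 -r2 leq_add2l.
have c1 : (\rank (W *m cy) <= 1)%N := rank_leq_col _.
suff z0 : \rank (W1 :&: kermx pz) = 0%N.
  rewrite z0 addn0 in r2; rewrite -ltnS -[(\rank W2).+1]add1n; apply: leq_trans rW _.
  by rewrite -r1 -/W1 -r2 leq_add2r.
apply/eqP; rewrite mxrank_eq0; apply/rowV0P => x.
have [a [b [z ->]]] := plane_vector x.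
rewrite !sub_capmx !sub_kermx cyE pzE => /andP[/andP[xW /eqP b0] /eqP z0].
have {}b0 : b = 0 by move/matrixP/(_ 0 0): b0; rewrite !mxE eqxx.
rewrite {}b0 {}z0 in xW *.
have /matrix0Pn[i [j]] : W *m cy != 0 by rewrite -mxrank_eq0.
have [a' [b' [z' wE]]] := plane_vector (row i W).
have -> : (W *m cy) i j = b'.
  have := row_mul i W cy; rewrite wE cyE => /matrixP/(_ 0 j).
  by rewrite [LHS]mxE => ->; rewrite (ord1 j) mxE eqxx.
(* Both [w] and [x + w] lie in [W], and their values differ by [a * b']; hence [a = 0]. *)
move=> b0; have wW := row_sub i W; rewrite wE in wW.
have := hW _ (addmx_sub xW wW); have := hW _ wW.
rewrite !add_row_mx -!raddfD /= !qv_plane !add0r mulrDl => h1.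
rewrite -addrA h1 addr0 => /eqP; rewrite mulf_eq0 (negPf b0) orbF => /eqP ->.
by rewrite !raddf0 !row_mx0.
Qed.

Lemma isotropic_rank_hyp k q n :
  isotropic_rank (osum (hyp F k) q) (n + k) -> isotropic_rank q n.
Proof.
elim: k => [|k IH] /=; rewrite ?addn0 ?addnS.
  exact: isotropic_rank_isometric (isometric_osum0 q).
move/(isotropic_rank_isometric (isometric_sym (isometric_osumA _ _ _))).
by move/isotropic_rank_plane_inv.
Qed.

Lemma qdim_hyp k : qdim (hyp F k) = (2 * k)%N.
Proof. by elim: k => // k IH; rewrite -[LHS]/(2 + qdim (hyp F k))%N IH mulnS. Qed.

Lemma isotropic_rank_hyp_full k : isotropic_rank (hyp F k) k.
Proof.
elim: k => [|k IH]; last exact: isotropic_rank_plane.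
by exists 0, 0; split=> // s; rewrite mulmx0 qv0.
Qed.

(** Dimensions give [dim q = 2 (l - k)], and removing [k] planes from the subspace of dimension [l]
    in [hyp F l] leaves dimension [l - k]. *)
Lemma witt0_isotropic_rank q : witt_equiv q (qzero F) ->
  exists2 n, isotropic_rank q n & (qdim q <= 2 * n)%N.
Proof.
case=> k [l h]; have := isometric_dim h.
rewrite -[X in X = _]/(qdim q + qdim (hyp F k))%N -[X in _ = X]/(0 + qdim (hyp F l))%N !qdim_hyp
  => d.
exists (l - k)%N; last lia.
apply: (@isotropic_rank_hyp k); apply: isotropic_rank_isometric (isometric_osumC _ _) _.
apply: isotropic_rank_isometric (isometric_sym h) _.
apply: isotropic_rank_isometric (isometric_sym (isometric_osum0 _)) _.
apply: isotropic_rank_leq (isotropic_rank_hyp_full l); lia.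
Qed.

Hypothesis char2 : 2%N \in [pchar F].

Lemma split_hyperbolic q (e : 'rV_(qdim q)) : nonsingular q -> e != 0 -> qv (qmx q) e = 0 ->
  exists q', [/\ isometric q (osum (qbin 0 0) q'), nonsingular q' & qdim q = (qdim q').+2].
Proof.
move=> ns e0 qe; have [b [q' [iso ns' d]]] := split_plane char2 ns e0.
exists q'; split=> //; apply: isometric_trans iso _; rewrite qe.
apply: isometric_osum; last exact: isometric_refl.
(* The substitution of [x + b y] for [x] carries [x y] to [x y + b y^2]. *)
apply/isometric_mxP; exists (block_mx 1%:M 0 b%:M 1%:M : 'M_(1 + 1)), (block_mx 1%:M 0 b%:M 1%:M
  : 'M_(1 + 1)).
have bb : block_mx 1%:M 0 b%:M 1%:M *m block_mx 1%:M 0 b%:M 1%:M = 1%:M :> 'M[F]_(1 + 1).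
  rewrite mulmx_block !mulmx1 !mul1mx !mulmx0 !mul0mx !addr0 !add0r (addvv_pchar2 _ char2).
  by rewrite -scalar_mx_block.
split=> // x; rewrite -(hsubmxK (x : 'rV_(1 + 1))) [lsubmx _]mx11_scalar [rsubmx _]mx11_scalar.
rewrite mul_row_block !mulmx0 !mulmx1 add0r -scalar_mxM -raddfD /= !qv_qbin; ring.
Qed.

Lemma isotropic_rank_witt0 q n : nonsingular q -> isotropic_rank q n -> (qdim q <= 2 * n)%N ->
  witt_equiv q (qzero F).
Proof.
elim: n q => [|n IH] q ns rq dq.
  apply: witt_equiv_isom; apply: (@isometricI _ _ _ (fun=> 0) (fun=> 0)) => //.
  - by move=> a u v; rewrite scaler0 addr0.
  - move=> x; apply/rowP=> i; have := ltn_ord i; lia.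
  - by move=> x; apply/rowP; case.
  - move=> x; rewrite qval0 (_ : x = 0) ?qv0 //; first exact/esym/qv0.
    apply/rowP=> i; have := ltn_ord i; lia.
have [k [W [rW hW]]] := rq.
have /matrix0Pn[i [j Wij]] : W != 0 by rewrite -mxrank_eq0; lia.
have e0 : row i W != 0 by apply: contra_neq Wij => /rowP/(_ j); rewrite !mxE.
have qe : qv (qmx q) (row i W) = 0 by rewrite rowE hW.
have [q' [iso ns' d]] := split_hyperbolic ns e0 qe.
have rq' := isotropic_rank_plane_inv (isotropic_rank_isometric iso rq).
apply: witt_equiv_trans (witt_equiv_isom iso) _.
apply: witt_equiv_trans (witt_equiv_osum (witt_equiv_refl _) (IH _ ns' rq' _)) _; first lia.
by exists 0, 1%N; apply: isometric_trans (isometric_osumC _ _) _; apply: isometric_refl.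
Qed.
End WittIndex.

(** * Purely inseparable extensions of exponent one *)

(** The sum of the planes [[a_k, b_k]], with all first coordinates before all second ones, so that a
    shear between the two halves is a block matrix. *)
Definition qstd (F : fieldType) m (a b : 'rV[F]_m) : qform F :=
  QForm (block_mx (diag_mx a) 1%:M 0 (diag_mx b)).

Lemma qv_diag (R : comNzRingType) m (a x : 'rV[R]_m) :
  qv (diag_mx a) x = \sum_i a 0 i * x 0 i ^+ 2.
Proof.
rewrite /qv mul_mx_diag mxE; apply: eq_bigr => i _; rewrite !mxE; ring.
Qed.

Lemma qv_qstd (F : fieldType) m (a b x y : 'rV[F]_m) :
  qv (qmx (qstd a b)) (row_mx x y) =
  \sum_i (a 0 i * x 0 i ^+ 2 + x 0 i * y 0 i + b 0 i * y 0 i ^+ 2).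
Proof.
rewrite [LHS]qv_block_upper !qv_diag mulmx1 mxE -!big_split /=.
by apply: eq_bigr => i _; rewrite !mxE.
Qed.

Lemma qext_qstd (F K : fieldType) (i : {rmorphism F -> K}) m (a b : 'rV[F]_m) :
  qext i (qstd a b) = qstd (map_mx i a) (map_mx i b).
Proof. by rewrite /qext /= map_block_mx !map_diag_mx map_mx1 raddf0. Qed.

Lemma nonsingular_qstd (F : fieldType) m (a b : 'rV[F]_m) :
  2%N \in [pchar F] -> nonsingular (qstd a b).
Proof.
move=> c2; apply/nonsingularP.
rewrite /= tr_block_mx add_block_mx !tr_diag_mx !(addvv_pchar2 _ c2) trmx1 trmx0 add0r addr0.
have /mulmx1_unit[] : block_mx 0 1%:M 1%:M 0 *m block_mx 0 1%:M 1%:M 0 = 1%:M :> 'M[F]_(m + m).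
  by rewrite mulmx_block !mulmx1 !mul0mx !mulmx0 !addr0 !add0r -scalar_mx_block.
by [].
Qed.

Lemma isometric_qstd (F : fieldType) (q : qform F) : 2%N \in [pchar F] -> nonsingular q ->
  exists m (a b : 'rV[F]_m), isometric q (qstd a b).
Proof.
move=> c2; have [n] := ubnP (qdim q); elim: n q => // n IH q dq ns.
have [d0|d0] := posnP (qdim q).
  exists 0, 0, 0; apply: (@isometricI _ _ _ (fun=> 0) (fun=> 0)) => //.
  - by move=> a u v; rewrite scaler0 addr0.
  - by move=> x; apply/rowP=> i; have := ltn_ord i; lia.
  - by move=> x; apply/rowP; case.
  - move=> x; rewrite (_ : x = 0) ?qvalE_qv ?qv0 //.
    by apply/rowP=> i; have := ltn_ord i; lia.
pose e : 'rV[F]_(qdim q) := delta_mx 0 (Ordinal d0).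
have e0 : e != 0.
  by apply/eqP => /rowP/(_ (Ordinal d0))/eqP; rewrite !mxE !eqxx oner_eq0.
have [b [q' [iso ns' d]]] := split_plane c2 ns e0.
have [|m [a' [b' iso']]] := IH q' _ ns'; first by move: dq; rewrite d; lia.
exists (1 + m)%N, (row_mx (qv (qmx q) e)%:M a'), (row_mx b%:M b').
apply: isometric_trans iso _; apply: isometric_trans (isometric_osum (isometric_refl _) iso') _.
apply: (@isometricI _ (osum (qbin (qv (qmx q) e) b) (qstd a' b')) (@qstd F (1 + m) (row_mx (qv
  (qmx q) e)%:M a') (row_mx b%:M b'))
  (fun x : 'rV_((1 + 1) + (m + m)) =>
     row_mx (row_mx (lsubmx (lsubmx x)) (lsubmx (rsubmx x)))
            (row_mx (rsubmx (lsubmx x)) (rsubmx (rsubmx x))))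
  (fun x : 'rV_((1 + m) + (1 + m)) =>
     row_mx (row_mx (lsubmx (lsubmx x)) (lsubmx (rsubmx x)))
            (row_mx (rsubmx (lsubmx x)) (rsubmx (rsubmx x))))).
- by do ?apply: linear_row_mx; move=> s u v; rewrite linearP ?linearP.
- by move=> x; rewrite !(row_mxKl, row_mxKr) !hsubmxK.
- by move=> x; rewrite !(row_mxKl, row_mxKr) !hsubmxK.
move=> x; rewrite qval_osum !qvalE_qv.
move: (lsubmx x) (rsubmx x) => x1 x2.
rewrite -[x1 in RHS](@hsubmxK _ _ 1 1) -[x2 in RHS](@hsubmxK _ _ m m).
rewrite [lsubmx x1]mx11_scalar [rsubmx x1]mx11_scalar !qv_qstd.
rewrite big_split_ord /= big_ord1 !row_mxEl qv_qbin; congr (_ + _).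
  by rewrite !mxE !eqxx !mulr1n; ring.
by apply: eq_bigr => k _; rewrite !row_mxEr.
Qed.

Lemma sqr_sum_pchar2 (R : comNzRingType) (I : Type) (r : seq I) (f : I -> R) :
  2%N \in [pchar R] -> (\sum_(k <- r) f k) ^+ 2 = \sum_(k <- r) f k ^+ 2.
Proof.
move=> c2; elim: r => [|k r IH]; first by rewrite !big_nil expr0n.
by rewrite !big_cons sqrrD IH (mulrn_pchar c2) addr0.
Qed.

Section Excellence.
Variables (F K : fieldType) (i : {rmorphism F -> K}).
Hypothesis char2 : 2%N \in [pchar F].
Hypothesis sqF : forall x : K, exists a : F, i a = x ^+ 2.

Let char2K : 2%N \in [pchar K] := rmorph_pchar i char2.

(* In a plane [al, be] over K a vector can be scaled or swapped to have first
   coordinate 0 or 1, the new coefficients [al x^2], [be / x^2] still lying in F. *)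
Lemma plane_adjust (al be : F) (x y : K) :
  exists (al' be' : F) (p q r s y' : K) (ep : bool),
  [/\ p * s + q * r = 1,
      i al' * p ^+ 2 + p * r + i be' * r ^+ 2 = i al,
      i al' * q ^+ 2 + q * s + i be' * s ^+ 2 = i be,
      x * p + y * q = ep%:R & x * r + y * s = y' /\ y' = ep%:R * y'].
Proof.
have [x0|x0] := eqVneq x 0; last first.
  have [c ic] := sqF x; exists (al * c), (be / c), x^-1, 0, 0, x, (x * y), true.
  rewrite rmorphM fmorph_div ic !(mulr0, mul0r, expr0n, addr0, add0r) !mul1r.
  split; first by rewrite mulVf.
  - by field.
  - by field.
  - by rewrite divff.
  - by rewrite mulrC.
have [y0|y0] := eqVneq y 0.
  exists al, be, 1, 0, 0, 1, 0, false; rewrite x0 y0.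
  by rewrite !(mulr0, mul0r, mulr1, expr1n, expr0n, addr0, add0r).
have [c ic] := sqF y; exists (be * c), (al / c), 0, y^-1, y, 0, 0, true.
rewrite rmorphM fmorph_div ic x0 !(mulr0, mul0r, expr0n, addr0, add0r).
split; first by rewrite mulVf.
- by field.
- by field.
- by rewrite divff.
- by split.
Qed.

Lemma qstd_diagonal_isometry m (a b a' b' p q r s : 'rV[K]_m) :
    (forall k, [/\ p 0 k * s 0 k + q 0 k * r 0 k = 1,
      a' 0 k * p 0 k ^+ 2 + p 0 k * r 0 k + b' 0 k * r 0 k ^+ 2 = a 0 k &
      a' 0 k * q 0 k ^+ 2 + q 0 k * s 0 k + b' 0 k * s 0 k ^+ 2 = b 0 k]) ->
  let M := block_mx (diag_mx p) (diag_mx r) (diag_mx q) (diag_mx s) in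
  (exists T, M *m T = 1%:M /\ T *m M = 1%:M) /\
  forall x, qv (qmx (qstd a' b')) (x *m M) = qv (qmx (qstd a b)) x.
Proof.
move=> h M; split.
  exists (block_mx (diag_mx s) (diag_mx r) (diag_mx q) (diag_mx p)).
  have hp k : p 0 k * s 0 k + q 0 k * r 0 k = 1 by have [] := h k.
  split; rewrite mulmx_block !mulmx_diag -!raddfD /=;
  rewrite [RHS]scalar_mx_block -!diag_const_mx -(raddf0 (@diag_mx K m)); congr block_mx;
    congr diag_mx;
  apply/rowP=> k; rewrite !mxE -?(hp k); try (by ring);
  by rewrite mulrC addrr_pchar2.
move=> x; rewrite -[x](@hsubmxK _ _ m m) mul_row_block !mul_mx_diag !qv_qstd.
apply: eq_bigr => k _; have [hp ha hb] := h k; rewrite !mxE -ha -hb.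
set x1 := x 0 (lshift m k); set x2 := x 0 (rshift m k); have two0 : 2%:R = 0 :> K := pcharf0 char2K.
transitivity ((a' 0 k * p 0 k ^+ 2 + p 0 k * r 0 k + b' 0 k * r 0 k ^+ 2) * x1 ^+ 2 +
    x1 * x2 * (p 0 k * s 0 k + q 0 k * r 0 k) +
    (a' 0 k * q 0 k ^+ 2 + q 0 k * s 0 k + b' 0 k * s 0 k ^+ 2) * x2 ^+ 2 +
    2%:R * (a' 0 k * p 0 k * q 0 k + b' 0 k * r 0 k * s 0 k) * (x1 * x2)).
  by ring.
by rewrite two0 !mul0r addr0 hp mulr1.
Qed.

(** Applied in every plane: a nonzero component gets first coordinate 1, a zero one stays zero. The
    last condition says that the second coordinate vanishes together with the first. *)
Lemma isotropic_normalize m (a b : 'rV[F]_m) (x y : 'rV[K]_m) :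
  exists (a' b' : 'rV[F]_m) (ep : 'I_m -> bool) (y' : 'rV[K]_m) M T,
  let e := \row_k (ep k)%:R in
  [/\ M *m T = 1%:M, T *m M = 1%:M,
    forall z, qv (qmx (qstd (map_mx i a') (map_mx i b'))) (z *m M) =
      qv (qmx (qstd (map_mx i a) (map_mx i b))) z,
    row_mx x y *m M = row_mx e y' & forall k, y' 0 k = e 0 k * y' 0 k].
Proof.
have /fin_all_exists[a' /fin_all_exists[b' /fin_all_exists[p /fin_all_exists[q /fin_all_exists[r
  /fin_all_exists[s /fin_all_exists[y' /fin_all_exists[ep h]]]]]]]] k :=
  plane_adjust (a 0 k) (b 0 k) (x 0 k) (y 0 k).
have [|[T [MT TM]] hM] := @qstd_diagonal_isometry m (map_mx i a) (map_mx i b)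
  (map_mx i (\row_k a' k)) (map_mx i (\row_k b' k)) (\row_k p k) (\row_k q k) (\row_k r k)
    (\row_k s k).
  by move=> k; rewrite !mxE; have [] := h k.
move: MT TM hM; set M := block_mx _ _ _ _ => MT TM hM.
exists (\row_k a' k), (\row_k b' k), ep, (\row_k y' k), M, T; split=> //.
  rewrite mul_row_block !mul_mx_diag; congr row_mx; apply/rowP=> k; rewrite !mxE.
    by have [_ _ _ ->] := h k.
  by have [_ _ _ _ [->]] := h k.
by move=> k; rewrite !mxE; have [_ _ _ _ []] := h k.
Qed.

(* The shear [(x, y) |-> (x, y + x S)] with [S] alternating changes [a_k] by
   [\sum_l S_kl^2 b_l], which lies in F since K^2 is contained in F. *)
Lemma isotropic_descent m (a b : 'rV[F]_m) (ep : 'I_m -> bool) (y : 'rV[K]_m) :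
    let e := \row_k (ep k)%:R in (forall k, y 0 k = e 0 k * y 0 k) -> row_mx e y != 0 ->
    qv (qmx (qstd (map_mx i a) (map_mx i b))) (row_mx e y) = 0 ->
  exists a' : 'rV[F]_m, isometric (qext i (qstd a b)) (qext i (qstd a' b)) /\
    exists2 v, v != 0 & qv (qmx (qstd a' b)) v = 0.
Proof.
move=> e ye ey0 iso1; have iso0 := iso1; rewrite qv_qstd in iso0.
have [k0 epk0] : exists k0, ep k0.
  apply: contrapT => h; case/eqP: ey0; rewrite -row_mx0.
  have e0 : e = 0.
    by apply/rowP=> k; rewrite !mxE; case E : (ep k) => //; case: h; exists k.
  by rewrite e0; congr row_mx; apply/rowP=> k; rewrite ye e0 !mxE mul0r.
(* Since [e_k y_k = y_k], isotropy expresses the sum of the [y_k] through [a_k], [b_k] and the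
   squares [y_k^2], all in F. *)
have [eta heta] : exists eta, i eta = \sum_k y 0 k.
  have /fin_all_exists[c hc] k := sqF (y 0 k).
  exists (- \sum_k (a 0 k * (ep k)%:R ^+ 2 + b 0 k * c k)).
  rewrite rmorphN rmorph_sum /=; apply/eqP;
    rewrite eq_sym -addr_eq0 -big_split /= -[X in _ == X]iso0.
  apply/eqP/eq_bigr => k _; rewrite !(rmorphD, rmorphM, rmorphXn, rmorph_nat) hc !mxE.
  have := ye k; rewrite mxE => <-; ring.
(* The correction at [k0], where [e] is 1, makes the scalar product of [e] and [w] zero. *)
pose w : 'rV[K]_m := y + (i eta) *: delta_mx 0 k0.
have ek0 : e 0 k0 = 1 by rewrite mxE epk0.
have ew : \sum_k e 0 k * w 0 k = 0.
  under eq_bigr => k _ do rewrite [w 0 k]mxE mulrDr -ye.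
  rewrite big_split /= -heta (bigD1 k0) //= big1 => [|k kk0].
    by rewrite !mxE epk0 !eqxx mul1r mulr1 addr0 addrr_pchar2.
  by rewrite !mxE eqxx (negPf kk0) !mulr0.
(* For [S = d^T w - w^T d], the products [e d^T = 1] and [e w^T = 0] give [e S = w]. *)
pose d : 'rV[K]_m := delta_mx 0 k0; pose U := d^T *m w; pose S := U - U^T.
have eS : e *m S = w.
  rewrite /S /U mulmxBr trmx_mul trmxK !mulmxA.
  have -> : e *m d^T = 1%:M.
    by rewrite trmx_delta -colE [LHS]mx11_scalar [col _ _ _ _]mxE ek0.
  have -> : e *m w^T = 0.
    by apply/matrixP=> k l; rewrite !ord1 [LHS]mxE [RHS]mxE;
      under eq_bigr => ? _ do rewrite [w^T _ _]mxE.
  by rewrite mul1mx mul0mx subr0.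
have Salt x : qv S x = 0 by apply: qv_alternating.
have /fin_all_exists[sq hsq] (kl : 'I_m * 'I_m) := sqF (S kl.1 kl.2).
pose a' : 'rV[F]_m := \row_k (a 0 k + \sum_l sq (k, l) * b 0 l).
exists a'.
pose M : 'M[K]_(m + m) := block_mx 1%:M S 0 1%:M.
have MM : M *m M = 1%:M.
  rewrite mulmx_block !mulmx1 !mul1mx !mulmx0 !mul0mx !addr0 !add0r (addvv_pchar2 _ char2K).
  by rewrite -scalar_mx_block.
have hM z : qv (qmx (qstd (map_mx i a) (map_mx i b))) (z *m M) =
    qv (qmx (qstd (map_mx i a') (map_mx i b))) z.
  rewrite -[z](@hsubmxK _ _ m m) /M mul_row_block !mulmx1 mulmx0 addr0.
  move: (lsubmx z) (rsubmx z) => x z2.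
  have xS0 : (x *m (x *m S)^T) 0 0 = 0.
    by rewrite -[x *m (_)^T]trmxK trmx_mul trmxK mxE; apply: Salt.
  have qb : qv (diag_mx (map_mx i b)) (x *m S + z2) =
      qv (diag_mx (map_mx i b)) (x *m S) + qv (diag_mx (map_mx i b)) z2.
    by rewrite qvD /bv tr_diag_mx (addvv_pchar2 _ char2K) mulmx0 mul0mx [X in _ + X]mxE addr0.
  have qa : qv (diag_mx (map_mx i a')) x =
      qv (diag_mx (map_mx i a)) x + qv (diag_mx (map_mx i b)) (x *m S).
    rewrite !qv_diag.
    under [X in _ + X]eq_bigr => l _.
      rewrite mxE (_ : (x *m S) 0 l ^+ 2 = \sum_k (x 0 k * S k l) ^+ 2); last first.
        by rewrite mxE; apply: sqr_sum_pchar2 char2K.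
      rewrite mulr_sumr.
    over.
    rewrite exchange_big -big_split /=; apply: eq_bigr => k _.
    rewrite !mxE rmorphD rmorph_sum mulrDl mulr_suml; congr (_ + _).
    by apply: eq_bigr => l _; rewrite rmorphM hsq /=; ring.
  rewrite [LHS]qv_block_upper [RHS]qv_block_upper !mulmx1 linearD /= mulmxDr [X in _ + X + _]mxE
    xS0 add0r qb qa.
  by rewrite [RHS]addrAC -!addrA; congr (_ + _); rewrite addrC addrA.
(* As [w] and [y] differ by a vector over F, the isotropic vector is the shear of a vector with
   entries in F. *)
have vM : map_mx i (row_mx (\row_k (ep k)%:R) (eta *: delta_mx 0 k0)) *m M = row_mx e y.
  rewrite map_row_mx mul_row_block !mulmx1 mulmx0 addr0 map_mxZ map_delta_mx.
  have -> : map_mx i (\row_k (ep k)%:R) = e by apply/rowP=> k; rewrite !mxE rmorph_nat.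
  by rewrite eS /w -addrA (addvv_pchar2 _ char2K) addr0.
split.
  by rewrite !qext_qstd; apply: isometric_sym; apply/isometric_mxP; exists M, M; split.
exists (row_mx (\row_k (ep k)%:R) (eta *: delta_mx 0 k0)).
  apply/eqP; rewrite -row_mx0 => /eq_row_mx[/rowP/(_ k0)/eqP].
  by rewrite !mxE epk0 oner_eq0.
apply: (fmorph_inj i); rewrite rmorph0 -iso1 -vM hM -(qv_map i).
by congr qv; rewrite /= map_block_mx !map_diag_mx map_mx1 raddf0.
Qed.

(** Every form in the chain (sum of planes, normalized, sheared) has its coefficients in F, although
    the isometries between them need K. The last form is isotropic over F, so its hyperbolic plane
    splits off there. *)
Lemma isotropic_excellence (q : qform F) (v : 'rV[K]_(qdim q)) : nonsingular q ->
    v != 0 -> qv (qmx (qext i q)) v = 0 ->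
  exists q', [/\ nonsingular q', qdim q = (qdim q').+2 &
    isometric (qext i q) (osum (qbin 0 0) (qext i q'))].
Proof.
move=> ns v0 qv0; have [m [a [b iso]]] := isometric_qstd char2 ns.
have isoK := isometric_qext i iso; rewrite qext_qstd in isoK.
have /isometric_mxP[S [T [ST TS hS]]] := isoK.
pose x := lsubmx (v *m S : 'rV_(m + m)); pose y := rsubmx (v *m S : 'rV_(m + m)).
have [a' [b' [ep [y' [M [N [MN NM hM xyM hy]]]]]]] := isotropic_normalize a b x y.
have xyE : row_mx x y = v *m S by rewrite hsubmxK.
have [||a2 [iso2 [w w0 hw]]] := @isotropic_descent m a' b' ep y' hy.
- rewrite -xyM xyE; apply: contra_neq v0 => vSM.
  by rewrite -[v]mulmx1 -ST -[S]mulmx1 -MN !mulmxA vSM !mul0mx.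
- by rewrite -xyM hM xyE hS.
have [q' [iso' ns' d']] := split_hyperbolic char2 (nonsingular_qstd char2) w0 hw.
exists q'; split=> //; first by rewrite (isometric_dim iso) -d'.
apply: isometric_trans isoK _.
apply: (isometric_trans (r := qstd (map_mx i a') (map_mx i b'))).
  by apply/isometric_mxP; exists M, N; split.
rewrite -qext_qstd; apply: isometric_trans iso2 _.
apply: isometric_trans (isometric_qext i iso') _.
rewrite qext_osum; apply: isometric_osum (isometric_refl _).
by rewrite /qext /qbin /= map_block_mx !map_scalar_mx !raddf0 !rmorph1; apply: isometric_refl.
Qed.

End Excellence.

Lemma witt_descent (F K : fieldType) (i : {rmorphism F -> K}) (q : qform F) n :
    2%N \in [pchar F] -> (forall x : K, exists a : F, i a = x ^+ 2) ->
    nonsingular q -> isotropic_rank (qext i q) n ->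
  exists q', [/\ nonsingular q', qdim q = (qdim q' + 2 * n)%N &
    witt_equiv (qext i q) (qext i q')].
Proof.
move=> c2 sqF; elim: n q => [|n IH] q ns rq.
  by exists q; split=> //; rewrite ?muln0 ?addn0 //; apply: witt_equiv_refl.
have [k [W [rW hW]]] := rq.
have /matrix0Pn[j [l Wjl]] : W != 0 by rewrite -mxrank_eq0; lia.
have e0 : row j W != 0 by apply: contra_neq Wjl => /rowP/(_ l); rewrite !mxE.
have qe : qv (qmx (qext i q)) (row j W) = 0 by rewrite rowE hW.
have [q1 [ns1 d1 iso]] := isotropic_excellence c2 sqF ns e0 qe.
have r1 := isotropic_rank_plane_inv (isotropic_rank_isometric iso rq).
have [q' [ns' d' w']] := IH _ ns1 r1.
exists q'; split=> //; first by rewrite d1 d'; lia.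
apply: witt_equiv_trans w'; exists 0%N, 1%N.
apply: isometric_trans (isometric_osumC _ _) _.
apply: isometric_trans (isometric_osum0 _) _.
apply: isometric_trans iso _; apply: isometric_trans (isometric_osumC _ _) _.
apply: isometric_osum (isometric_refl _) _.
by apply: isometric_trans (isometric_osumC _ _); apply: isometric_sym (isometric_osum0 _).
Qed.

(** * Tensor products and Pfister forms *)

Section TensorProducts.
Variable F : fieldType.

Definition untens m n (x : 'rV[F]_(m * n)) : 'M_(m, n) := \matrix_(i, k) x 0 (mxtens_index (i, k)).
Definition tens m n (X : 'M[F]_(m, n)) : 'rV_(m * n) :=
  \row_h X (mxtens_unindex h).1 (mxtens_unindex h).2.

Lemma untensK m n : cancel (@untens m n) (@tens m n).
Proof.
by move=> x; apply/rowP=> h; rewrite !mxE -surjective_pairing mxtens_unindexK.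
Qed.

Lemma tensK m n : cancel (@tens m n) (@untens m n).
Proof. by move=> X; apply/matrixP=> i k; rewrite !mxE mxtens_indexK. Qed.

Lemma untens_linear m n : linear (@untens m n).
Proof. by move=> a x y; apply/matrixP=> i k; rewrite !mxE. Qed.

Lemma tens_linear m n : linear (@tens m n).
Proof. by move=> a x y; apply/rowP=> i; rewrite !mxE. Qed.

Lemma sum_mxtens m n (f : 'I_(m * n) -> F) :
  \sum_h f h = \sum_i \sum_k f (mxtens_index (i, k)).
Proof.
rewrite pair_big /= (reindex (fun ik : 'I_m * 'I_n => mxtens_index ik)) /=.
  by apply: eq_bigr => -[i k] _.
by exists (@mxtens_unindex m n) => h _; rewrite ?mxtens_indexK ?mxtens_unindexK.
Qed.

Lemma qv_tens m n (b : 'M[F]_m) (A : 'M[F]_n) x : qv (b *t A) x =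
  \sum_i \sum_j b i j * (row i (untens x) *m A *m (row j (untens x))^T) 0 0.
Proof.
rewrite qv_sum sum_mxtens; apply: eq_bigr => i _.
under eq_bigr => k _ do rewrite sum_mxtens.
rewrite exchange_big; apply: eq_bigr => j _.
rewrite [X in _ * X]mxE mulr_sumr exchange_big; apply: eq_bigr => l _.
rewrite mxE mulr_suml mulr_sumr; apply: eq_bigr => k _.
rewrite tensmxE !mxE; ring.
Qed.

Lemma qvZm (d : F) n (A : 'M[F]_n) x : qv (d *: A) x = d * qv A x.
Proof. by rewrite /qv -scalemxAr -scalemxAl mxE. Qed.

Lemma isometric_scale (d : F) q : isometric (QForm (d *: qmx q)) (qtens (d%:M : 'M_1) q).
Proof.
apply: (@isometricI _ (QForm (d *: qmx q)) (qtens (d%:M : 'M_1) q)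
  (fun x : 'rV_(qdim q) => @tens 1 _ x) (fun x => row 0 (@untens 1 (qdim q) x))).
- exact: tens_linear.
- by move=> x; rewrite tensK; apply/rowP=> k; rewrite mxE.
- by move=> x; rewrite (_ : row 0 _ = untens x) ?untensK //; apply/matrixP=> i k; rewrite mxE ord1.
move=> x; rewrite qvalE_qv [LHS](@qv_tens 1) !big_ord1 tensK mxE eqxx mulr1n.
rewrite (_ : row 0 x = x); last by apply/rowP=> k; rewrite mxE.
by rewrite qvalE_qv qvZm.
Qed.

Lemma isometric_tens_bilin1 (c : F) q :
  isometric (qtens (bilin1 c) q) (osum q (QForm (c *: qmx q))).
Proof.
pose g (y : 'rV_(qdim q + qdim q)) := tens (col_mx (lsubmx y) (rsubmx y) : 'M_(1 + 1, _)).
apply: (@isometricI _ (qtens (bilin1 c) q) (osum q (QForm (c *: qmx q)))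
  (fun x : 'rV_(2 * qdim q) => row_mx (row 0 (untens x)) (row 1 (untens x)) : 'rV_(qdim q + qdim
    q)) g).
- by apply: linear_row_mx => a u v; rewrite untens_linear; apply/rowP=> k; rewrite !mxE.
- move=> x; rewrite /g row_mxKl row_mxKr -[RHS]untensK; congr tens.
  by apply/matrixP=> i k; rewrite mxE; case: splitP => j ij; rewrite !mxE;
    congr (x 0 (mxtens_index (_, _))); apply: ord_inj; rewrite ij ord1.
- move=> y; rewrite /g tensK -[RHS](hsubmxK y); congr row_mx.
    apply/rowP=> k; rewrite mxE -[RHS](col_mxEu (lsubmx y) (rsubmx y) 0 k).
    by congr (col_mx _ _ _ k); apply: ord_inj.
  apply/rowP=> k; rewrite mxE -[RHS](col_mxEd (lsubmx y) (rsubmx y) 0 k).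
  by congr (col_mx _ _ _ k); apply: ord_inj.
move=> x; rewrite qval_osum !qvalE_qv row_mxKl row_mxKr [RHS]qv_tens.
have bE (i j : 'I_2) : bilin1 c i j = (if i == 0 then 1 else c) *+ (i == j) by rewrite !mxE.
rewrite !big_ord_recl !big_ord0 !bE /= !mulr1n !mulr0n !mul0r !addr0 !add0r mul1r qvZm.
by rewrite (_ : lift ord0 ord0 = 1) //; apply: ord_inj.
Qed.

Lemma isometric_tens_block m1 m2 (b1 : 'M[F]_m1) (b2 : 'M[F]_m2) q :
  isometric (osum (qtens b1 q) (qtens b2 q)) (qtens (block_mx b1 0 0 b2) q).
Proof.
apply: (@isometricI _ (osum (qtens b1 q) (qtens b2 q)) (qtens (block_mx b1 0 0 b2) q)
  (fun x : 'rV_(m1 * qdim q + m2 * qdim q) => tens (col_mx (untens (lsubmx x)) (untens (rsubmx x))))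
  (fun y => row_mx (tens (usubmx (untens y : 'M_(m1 + m2, _)))) (tens (dsubmx (untens y : 'M_(m1
    + m2, _)))))).
- by move=> a u v; rewrite !linearP /= !untens_linear -tens_linear scale_col_mx add_col_mx.
- by move=> x; rewrite tensK col_mxKu col_mxKd !untensK hsubmxK.
- by move=> y; rewrite row_mxKl row_mxKr !tensK vsubmxK untensK.
move=> x; rewrite qval_osum !qvalE_qv !qv_tens tensK big_split_ord /=.
congr (_ + _); apply: eq_bigr => i _; rewrite big_split_ord /=.
  rewrite [X in _ + X = _]big1 ?addr0 => [|j _]; last by rewrite block_mxEur mxE mul0r.
  by apply: eq_bigr => j _; rewrite block_mxEul !rowKu.
rewrite [X in X + _ = _]big1 ?add0r => [|j _]; last by rewrite block_mxEdl mxE mul0r.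
by apply: eq_bigr => j _; rewrite block_mxEdr !rowKd.
Qed.

(** The subspace is the tensor product of [F^m] and [W]. On it the form has matrix [b *t (U - U^T)],
    which is alternating because [b] is symmetric. *)
Lemma isotropic_rank_tens m (b : 'M[F]_m) q n : b^T = b ->
  isotropic_rank q n -> isotropic_rank (qtens b q) (m * n).
Proof.
move=> sb [k [W [rW hW]]]; pose W0 := row_base W.
have hW0 s : qv (qmx q) (s *m W0) = 0.
  have /submxP[D ->] : (s *m W0 <= W)%MS by rewrite (submx_trans (submxMl _ _)) ?eq_row_base.
  exact: hW.
exists _, ((1%:M : 'M_m) *t W0); split.
  have t11 : (1%:M : 'M[F]_m) *t (1%:M : 'M[F]_(\rank W)) = 1%:M.
    apply/matrixP=> x y; case: (mxtens_indexP x) => i h; case: (mxtens_indexP y) => j l.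
    by rewrite tensmxE !mxE -natrM mulnb (inj_eq (can_inj (@mxtens_indexK _ _))).
  have h : ((1%:M : 'M_m) *t W0) *m ((1%:M : 'M_m) *t pinvmx W0) = 1%:M.
    by rewrite tensmx_mul mulmx1 mulmxVp ?row_base_free.
  apply: leq_trans (mxrankM_maxl _ ((1%:M : 'M_m) *t pinvmx W0)).
  by rewrite h mxrank1 leq_mul2l rW orbT.
move=> s; rewrite qv_mul trmx_tens !tensmx_mul trmx1 mul1mx mulmx1.
have [U ->] : exists U, W0 *m qmx q *m W0^T = 0 + (U - U^T).
  by apply: qv_eq_alternating => x; rewrite -qv_mul hW0 /qv mulmx0 mul0mx mxE.
rewrite add0r (_ : b *t (U - U^T) = b *t U - (b *t U)^T) ?qv_alternating //.
by rewrite trmx_tens sb; apply/matrixP=> x y; rewrite !mxE mulrBr.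
Qed.
End TensorProducts.

(** * Round forms and isotropic Pfister forms *)

Section PfisterForms.
Variable F : fieldType.
Hypothesis char2 : 2%N \in [pchar F].
Implicit Types q r : qform F.

(** Every nonzero value is the factor of a similitude. At [q(x) = 0] the condition is void, as
    [M = 0] satisfies it. *)
Definition round q := forall x, exists M : 'M_(qdim q), forall v,
  qv (qmx q) (v *m M) = qv (qmx q) x * qv (qmx q) v.

Lemma similitude_bv q (M : 'M_(qdim q)) c :
    (forall v, qv (qmx q) (v *m M) = c * qv (qmx q) v) ->
  forall u v, bv (qmx q) (u *m M) (v *m M) = c * bv (qmx q) u v.
Proof.
move=> h u v; apply: (addrI (qv (qmx q) (u *m M) + qv (qmx q) (v *m M))).
by rewrite -qvD -mulmxDl !h qvD !mulrDr.
Qed.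

Lemma similitude_unit q (M : 'M_(qdim q)) c : nonsingular q -> c != 0 ->
  (forall v, qv (qmx q) (v *m M) = c * qv (qmx q) v) -> M \in unitmx.
Proof.
move=> ns c0 h; rewrite -row_free_unit -kermx_eq0; apply/eqP/row_matrixP => i.
rewrite row0; apply: ns => y; rewrite polar_bv; apply: (mulfI c0).
by rewrite -(similitude_bv h) -row_mul mulmx_ker row0 bv0l mulr0.
Qed.

Lemma round_isometric q r : isometric q r -> round q -> round r.
Proof.
move=> /isometric_mxP[S [T [ST TS h]]] rq x.
have hT y : qv (qmx q) (y *m T) = qv (qmx r) y by rewrite -h -mulmxA TS mulmx1.
have [M hM] := rq (x *m T); exists (T *m M *m S) => v.
by rewrite !mulmxA h hM !hT.
Qed.

Lemma round_qbin a : round (qbin 1 a).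
Proof.
move=> x; rewrite -(hsubmxK (x : 'rV_(1 + 1))) [lsubmx _]mx11_scalar [rsubmx _]mx11_scalar.
set x1 := lsubmx _ _ _; set x2 := rsubmx _ _ _.
(* [[1, a]] is the norm form of the algebra with [w^2 = w + a]; the matrix is multiplication by
   [x1 + x2 w]. *)
exists (block_mx x1%:M x2%:M (a * x2)%:M (x1 + x2)%:M : 'M_(1 + 1)) => v.
rewrite -(hsubmxK (v : 'rV_(1 + 1))) [lsubmx v]mx11_scalar [rsubmx v]mx11_scalar.
set v1 := lsubmx _ _ _; set v2 := rsubmx _ _ _.
rewrite mul_row_block -!scalar_mxM -!raddfD /= !qv_qbin !mulr1.
have two0 : 2%:R = 0 :> F := pcharf0 char2.
transitivity ((x1 ^+ 2 + x1 * x2 + x2 ^+ 2 * a) * (v1 ^+ 2 + v1 * v2 + v2 ^+ 2 * a) +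
    2%:R * (a * v2 * (x1 * x2 * v1 *+ 2 + x2 ^+ 2 * v2 + x2 ^+ 2 * v1 + x1 * x2 * v2))).
  ring.
by rewrite two0 mul0r addr0.
Qed.

Lemma round_double c q : nonsingular q -> round q -> round (osum q (QForm (c *: qmx q))).
Proof.
move=> ns rq x; rewrite -(hsubmxK (x : 'rV_(qdim q + qdim q))).
set x1 := lsubmx _; set x2 := rsubmx _; have [M1 h1] := rq x1; have [M2 h2] := rq x2.
pose val (u v : 'rV[F]_(qdim q)) := qv (qmx q) u + c * qv (qmx q) v.
have valE u v : qv (qmx (osum q (QForm (c *: qmx q)))) (row_mx u v) = val u v.
  by rewrite [LHS]qv_block_diag qvZm.
suff [N hN] : exists N : 'M_(qdim q + qdim q), forall u v, qv (qmx (osum q (QForm (c *: qmx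
  q)))) (row_mx u v *m N) = val x1 x2 * val u v.
  exists N => y; rewrite -(hsubmxK (y : 'rV_(qdim q + qdim q))).
  by rewrite hN [qv _ (row_mx x1 x2)]valE [in RHS]valE.
rewrite /val; set r := qv _ x1 in h1 *; set s := qv _ x2 in h2 *.
have [s0|s0] := eqVneq s 0.
  exists (block_mx M1 0 0 M1) => u v.
  by rewrite mul_row_block !mulmx0 addr0 add0r valE /val !h1 s0; ring.
have [r0|r0] := eqVneq r 0.
  exists (block_mx 0 M2 (c *: M2) 0) => u v.
  by rewrite mul_row_block !mulmx0 addr0 add0r valE /val -scalemxAr qvZ !h2 r0; ring.
have uM1 := similitude_unit ns r0 h1.
(* [N] is chosen with [q(v N) = r q(v)] and [B(u M2, v N) = B(u M1, v M2)], so that the two mixed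
   terms cancel in characteristic 2. *)
pose N := (r / s) *: (M2 *m invmx M1 *m M2).
have hV w : qv (qmx q) (w *m invmx M1) = qv (qmx q) w / r.
  by rewrite -[in RHS](mulmxKV uM1 w) h1 mulrC mulKf.
exists (block_mx M1 M2 (c *: M2) N) => u v.
rewrite mul_row_block valE /val -scalemxAr !qvD qvZ !h1 !h2 /N -scalemxAr qvZ !mulmxA !h2 hV h2
  !bvZr.
rewrite (similitude_bv h2) -[in bv _ (u *m M1) _](mulmxKV uM1 (v *m M2)) (similitude_bv h1).
set b := bv _ _ _; have two0 : 2%:R = 0 :> F := pcharf0 char2.
transitivity ((r + c * s) * (qv (qmx q) u + c * qv (qmx q) v) + 2%:R * (c * r * b)).
  by field; rewrite r0 s0.
by rewrite two0 mul0r addr0.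
Qed.

(* Hyperbolicity is witnessed by a totally isotropic subspace of half dimension. *)
Definition isotropic_hyperbolic q := forall e, e != 0 -> qv (qmx q) e = 0 ->
  exists2 n, isotropic_rank q n & (qdim q <= 2 * n)%N.

Lemma isotropic_hyperbolic_isometric q r : isometric q r ->
  isotropic_hyperbolic q -> isotropic_hyperbolic r.
Proof.
move=> iso hq e e0 re; have /isometric_mxP[S [T [ST TS h]]] := iso.
have [||n rn dn] := hq (e *m T).
- by apply: contra_neq e0 => eT; rewrite -[e]mulmx1 -TS mulmxA eT mul0mx.
- by rewrite -h -mulmxA TS mulmx1.
by exists n; [apply: isotropic_rank_isometric iso rn | rewrite -(isometric_dim iso)].
Qed.

(** For an isotropic [(x, y)] with [q(y) != 0], the similitudes of factors [q(x)] and [q(y)] give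
    the totally isotropic space of all [(s M1, s M2)]. If [q(y) = 0] then [q] itself is isotropic,
    and two copies of its subspace suffice. *)
Lemma isotropic_hyperbolic_double c q : nonsingular q -> round q ->
  isotropic_hyperbolic q -> isotropic_hyperbolic (osum q (QForm (c *: qmx q))).
Proof.
move=> ns rq hq e.
rewrite -(hsubmxK (e : 'rV_(qdim q + qdim q))); set x := lsubmx _; set y := rsubmx _.
move=> e0; rewrite [LHS]qv_block_diag qvZm => exy.
have [y0|y0] := eqVneq (qv (qmx q) y) 0.
  have [n [k [W [rW hW]]] dn] : exists2 n, isotropic_rank q n & (qdim q <= 2 * n)%N.
    have [yz|yz] := eqVneq y 0; last exact: hq y0.
    apply: (hq x); last by move: exy; rewrite y0 mulr0 addr0.
    by apply: contra_neq e0 => ->; rewrite yz row_mx0.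
  exists (n + n)%N; last by rewrite -[qdim _]/(qdim q + qdim q)%N; lia.
  exists (k + k)%N, (block_mx W 0 0 W); split; first by rewrite rank_diag_block_mx leq_add.
  move=> s; rewrite -(hsubmxK s) mul_row_block !mulmx0 addr0 add0r.
  by rewrite [LHS]qv_block_diag qvZm !hW mulr0 addr0.
have [M1 h1] := rq x; have [M2 h2] := rq y.
exists (qdim q); last by rewrite -[X in (X <= _)%N]/(qdim q + qdim q)%N; lia.
exists (qdim q), (row_mx M1 M2); split.
  have uM2 := similitude_unit ns y0 h2.
  have : row_mx M1 M2 *m col_mx 0 (invmx M2) = 1%:M by rewrite mul_row_col mulmx0 add0r mulmxV.
  by move=> h; apply: leq_trans (mxrankM_maxl _ (col_mx 0 (invmx M2))); rewrite h mxrank1.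
move=> s; rewrite mul_mx_row [LHS]qv_block_diag qvZm h1 h2 mulrA -mulrDl.
by rewrite [X in X * _]exy mul0r.
Qed.

Lemma isotropic_hyperbolic_qbin a b : isotropic_hyperbolic (qbin a b).
Proof.
move=> e e0 qe; exists 1%N => //; exists 1%N, e; split; first by rewrite rank_rV e0.
by move=> s; rewrite [s]mx11_scalar mul_scalar_mx qvZ qe mulr0.
Qed.

Lemma pfister_round (s : seq F) (a : F) : 0 \notin s ->
  [/\ round (pfister s a), isotropic_hyperbolic (pfister s a) & nonsingular (pfister s a)].
Proof.
elim: s => [_|c s IH] /=.
  split; [exact: round_qbin | exact: isotropic_hyperbolic_qbin |].
  by apply: (@is_pfister_nonsingular _ 1) => //; exists [::], a; split=> //; apply: isometric_refl.
move=> hs; have := hs; rewrite inE negb_or => /andP[c0 /IH[r h ns]].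
have iso := isometric_sym (isometric_tens_bilin1 c (pfister s a)).
split.
- exact: round_isometric iso (round_double ns r).
- exact: isotropic_hyperbolic_isometric iso (isotropic_hyperbolic_double ns r h).
- apply: (@is_pfister_nonsingular _ (size (c :: s)).+1) => //; exists (c :: s), a; split=> //.
  exact: isometric_refl.
Qed.

Lemma pfister_unit (s : seq F) (a : F) : exists e, qv (qmx (pfister s a)) e = 1.
Proof.
elim: s => [|c s [e he]] /=.
  by exists (row_mx 1%:M 0%:M); rewrite qv_qbin; ring.
have /isometric_mxP[S [T [ST TS h]]] := isometric_sym (isometric_tens_bilin1 c (pfister s a)).
by exists (row_mx e 0 *m S); rewrite h [LHS]qv_block_diag he qv0 addr0.
Qed.

Lemma qdim_pfister (s : seq F) (a : F) : qdim (pfister s a) = (2 * 2 ^ size s)%N.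
Proof.
elim: s => [|c s IH] //=; rewrite -[LHS]/(2 * qdim (pfister s a))%N IH expnS; lia.
Qed.

End PfisterForms.

Lemma qext_pfister (F K : fieldType) (i : {rmorphism F -> K}) (s : seq F) (a : F) :
  qext i (pfister s a) = pfister (map i s) (i a).
Proof.
elim: s => [|c s IH] /=.
  by rewrite /qext /= map_block_mx !map_scalar_mx rmorph1 raddf0.
rewrite -IH /qext /= map_mxT; congr (QForm (_ *t _)).
by rewrite /bilin1 map_diag_mx; congr diag_mx; apply/rowP=> k; rewrite !mxE; case: ifP;
  rewrite ?rmorph1.
Qed.

(** * Witt kernels *)

Lemma isotropic_rank_map (K E : fieldType) (h : {rmorphism K -> E}) q n :
  isotropic_rank q n -> isotropic_rank (qext h q) n.
Proof.
move=> [k [W [rW hW]]]; exists k, (map_mx h W); split; first by rewrite mxrank_map.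
move=> s; rewrite qv_mul map_trmx -!map_mxM.
rewrite (qv_eq_map h (D := 0)) => [|x]; last by rewrite -qv_mul hW /qv mulmx0 mul0mx mxE.
by rewrite map_mx0 /qv mulmx0 mul0mx mxE.
Qed.

Lemma isotropic_rank_bij (K E : fieldType) (h : {rmorphism K -> E}) q n :
  bijective h -> isotropic_rank (qext h q) n -> isotropic_rank q n.
Proof.
case=> g hK gK [k [W [rW hW]]].
pose W0 : 'M_(k, qdim q) := map_mx g W.
have WE : W = map_mx h W0 by apply/matrixP=> i j; rewrite !mxE gK.
exists k, W0; split; first by rewrite WE mxrank_map in rW.
by move=> s; apply: (fmorph_inj h); rewrite rmorph0 -qv_map map_mxM -WE hW.
Qed.

Lemma isometric_quadric_mx (F : fieldType) (b : F) (q : qform F) :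
  isometric (osum (qbin 1 b) q)
    (QForm (quadric_mx (block_mx b%:M 0 0 (qmx q) : 'M_(1 + qdim q)))).
Proof.
apply: (@isometricI _ (osum (qbin 1 b) q)
  (QForm (quadric_mx (block_mx b%:M 0 0 (qmx q) : 'M_(1 + qdim q))))
  (fun x : 'rV_(1 + 1 + qdim q) => row_mx (lsubmx (lsubmx x)) (row_mx (rsubmx (lsubmx x))
    (rsubmx x)))
  (fun x : 'rV_(1 + (1 + qdim q)) => row_mx (row_mx (lsubmx x) (lsubmx (rsubmx x))) (rsubmx
    (rsubmx x)))).
- apply: (@linear_row_mx _ _ 1 (1 + qdim q)); last apply: (@linear_row_mx _ _ 1 (qdim q));
    by move=> a u v; rewrite linearP ?linearP.
- by move=> x; rewrite !(row_mxKl, row_mxKr) !hsubmxK.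
- by move=> x; rewrite !(row_mxKl, row_mxKr) !hsubmxK.
move=> x; have [a [c [z ->]]] := plane_vector x; rewrite !(row_mxKl, row_mxKr) !qvalE_qv.
rewrite [LHS]qv_quadric_mx [RHS]qv_block_diag qv_qbin (@qv_block_diag _ 1) qv_scalar1.
have -> : row_mx c%:M z 0 0 = c.
  have <- : lshift (qdim q) (0 : 'I_1) = 0 :> 'I_(1 + qdim q) by apply: ord_inj.
  by rewrite row_mxEl mxE eqxx mulr1n.
by rewrite mxE eqxx mulr1n mulr1 addrA.
Qed.

Lemma hyperbolic_plane (F : fieldType) (q : qform F) (e : 'rV_(qdim q)) :
  2%N \in [pchar F] -> nonsingular q -> qdim q = 2 -> e != 0 -> qv (qmx q) e = 0 ->
  isometric q (qbin 0 0).
Proof.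
move=> c2 ns d e0 qe; have [q' [iso _ d']] := split_hyperbolic c2 ns e0 qe.
apply: isometric_trans iso _.
case: q' d' => [[|n] B] d'; last by move: d'; rewrite d.
apply: isometric_trans (isometric_osumC _ _) _.
rewrite (_ : existT _ _ _ = qzero F); last by congr existT; apply/matrixP; case.
exact: isometric_osum0.
Qed.

(** Since [p] represents 1 it is [[1, b] + p'], and adjoining a root [th] of its affine equation to
    the rational function field gives a field [E] into which [L] embeds over K. The half-dimensional
    subspace is carried to [E], where the generic argument applies. *)
Lemma function_field_subform (K L : fieldType) (j : {rmorphism K -> L}) (p q : qform K) e n :
    2%N \in [pchar K] -> nonsingular p -> qv (qmx p) e = 1 ->
    ~ isometric p (qbin 0 0) -> is_quadric_function_field j p ->
    anisotropic (qmx q) -> isotropic_rank (qext j q) n -> (qdim q <= 2 * n)%N ->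
  forall v, exists P : 'M_(qdim p, qdim q), forall s,
    qv (qmx q) (s *m P) = qv (qmx q) v * qv (qmx p) s.
Proof.
move=> c2 nsp pe nhyp [x [genx surj]] anisq rq dq v.
have e0 : e != 0.
  by apply/eqP => ez; move/eqP: pe; rewrite ez qv0 eq_sym oner_eq0.
have [b [p' [iso nsp' dp]]] := split_plane c2 nsp e0; rewrite pe in iso.
set m := qdim p' in dp; pose Q : 'M_m.+1 := block_mx b%:M 0 0 (qmx p') : 'M_(1 + m).
have /isometric_mxP[S [T [ST TS hS]]] := isometric_trans iso (isometric_quadric_mx b p').
have hT z : qv (qmx p) (z *m T) = qv (quadric_mx Q) z by rewrite -hS -mulmxA TS mulmx1.
have noroot z : z ^+ 2 + z * gens K m.+1 0 0 +
    qv (map_mx (ratC K m.+1) Q) (gens K m.+1) != 0.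
  (* For m = 0 a root [s] makes [(s, 1)] isotropic and [p] a hyperbolic plane. For m > 0 a
     nonsingular [p'] cannot vanish identically. *)
  apply: quadric_no_root => // [m0 s|m0].
    have ns1 := nonsingular_isometric iso nsp.
    apply/eqP => s0; apply: nhyp; apply: isometric_trans iso _.
    apply: (@hyperbolic_plane K (osum (qbin 1 b) p') (row_mx (row_mx s%:M 1%:M) 0)) => //.
    - by rewrite -[LHS]/(2 + m)%N m0.
    - rewrite -!row_mx0; apply/eqP => /eq_row_mx[/eq_row_mx[_ /matrixP/(_ 0 0)/eqP]].
      by rewrite !mxE oner_eq0.
    - by rewrite [LHS]qv_block_diag qv_qbin qv0 mulr1 expr1n mul1r addr0 -s0 mulr1.
  apply: contrapT => h; have : const_mx 1 = 0 :> 'rV[K]_m.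
    have q0 s : qv (qmx p') s = 0 by apply/eqP; apply: contrapT => /negP ?; apply: h; exists s.
    by apply: nsp' => y; rewrite /polar !qvalE_qv !q0 !subr0.
  by move/rowP/(_ (Ordinal m0))/eqP; rewrite !mxE oner_eq0.
have [E [f [th [hth gen]]]] := quadratic_extension noroot.
have gp0 := generic_point_quadric ST TS hT hth.
have gpI := generic_point_ideal ST TS hT noroot hth.
have [h hj] := function_field_hom genx surj gp0 gpI.
have [k [W [rW hW]]] := isotropic_rank_map h rq.
have [||P hP] := generic_quadric_subform c2 noroot hth gen anisq (W := W) _ _ v.
- by apply: leq_trans dq _; rewrite leq_mul2l.
- move=> s; rewrite -(hW s); congr (qv _ _); apply/matrixP=> a c.
  by rewrite !mxE hj.
exists (S *m (col_mx v P : 'M_(1 + m.+1, _))) => s.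
rewrite mulmxA -hS; move: (s *m S) => z.
rewrite -[z](@hsubmxK _ _ 1 m.+1) mul_row_col [lsubmx z]mx11_scalar mul_scalar_mx hP.
by rewrite [in RHS]qv_quadric_mx.
Qed.

Section WittGroup.
Variable F : fieldType.
Hypothesis char2 : 2%N \in [pchar F].

Lemma wq_addvv (w : Wq F) : w + w = 0.
Proof.
elim/wclass_ind: w => q; rewrite -wclassD -wclass0; apply/wclassP/hyperbolic_witt.
have := hyperbolic_oppr (@nonsingular_nsval F q).
rewrite (_ : qopp q = q) // /qopp (_ : - qmx q = qmx q); first by case: (nsval q).
by apply/matrixP=> i j; rewrite !mxE oppr_pchar2.
Qed.

Lemma W_tens0 (p : nsqform F) : W_tens p 0.
Proof.
have sb : (0 : 'M[F]_0)^T = 0 by rewrite trmx0.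
have ub : (0 : 'M[F]_0) \in unitmx by rewrite unitmxE det_mx00 unitr1.
exists 0, 0, sb, ub; rewrite -wclass0; apply/wclassP/witt_equiv_sym.
apply: (isotropic_rank_witt0 char2 (n := 0)) => //; first exact: nonsingular_nsval.
by exists 0%N, 0; split=> // s; rewrite mulmx0 qv0.
Qed.

Lemma W_tens_scale (p : nsqform F) d : d != 0 -> exists r : nsqform F,
  W_tens p (wclass r) /\ isometric r (QForm (d *: qmx p)).
Proof.
move=> d0; have sb : (d%:M : 'M_1)^T = d%:M by rewrite tr_scalar_mx.
have ub : (d%:M : 'M_1) \in unitmx by rewrite unitmxE det_scalar1 unitfE.
exists (nstens sb ub p); split; first by exists 1, d%:M, sb, ub.
exact: isometric_sym (isometric_scale _ _).
Qed.

Lemma W_tensD (p : nsqform F) v w : W_tens p v -> W_tens p w -> W_tens p (v + w).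
Proof.
move=> [m1 [b1 [s1 [u1 ->]]]] [m2 [b2 [s2 [u2 ->]]]].
have sb : (block_mx b1 0 0 b2)^T = block_mx b1 0 0 b2 by rewrite tr_block_mx s1 s2 !trmx0.
have ub : block_mx b1 0 0 b2 \in unitmx by rewrite unitmxE det_ublock unitrM -!unitmxE u1.
exists _, _, sb, ub; rewrite -wclassD; apply/wclassP/witt_equiv_isom.
exact: isometric_tens_block.
Qed.

End WittGroup.

Lemma qext_comp (F K L : fieldType) (i : {rmorphism F -> K}) (j : {rmorphism K -> L}) q :
  qext (j \o i)%FUN q = qext j (qext i q).
Proof. by rewrite /qext /= -map_mx_comp. Qed.

Lemma wext0P (F K : fieldType) (i : {rmorphism F -> K}) (q : nsqform F) :
  wext i (wclass q) = 0 <-> witt_equiv (qext i q) (qzero K).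
Proof. by rewrite wext_class -wclass0 wclassP. Qed.

Lemma mpolyX_homog (R : comNzRingType) n (k : 'I_n) : ('X_k : {mpoly R[n]}) \is 1.-homog.
Proof. by rewrite dhomogX; apply/eqP; apply: mdeg1. Qed.

Lemma quadric_poly_homog (K : fieldType) (q : qform K) : quadric_poly q \is 2.-homog.
Proof.
apply: rpred_sum => k _; apply: rpred_sum => l _; apply: dhomogZ.
by apply: (@dhomogM _ _ _ 1%N _ 1%N); apply: mpolyX_homog.
Qed.

(** The generic point is a nonzero isotropic vector of [p] over L, and an isotropic Pfister form is
    hyperbolic. *)
Lemma function_field_hyperbolic (K L : fieldType) (j : {rmorphism K -> L}) s a (p : qform K) :
    2%N \in [pchar K] -> 0 \notin s -> isometric p (pfister s a) -> is_function_field j p ->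
  exists2 n, isotropic_rank (qext j p) n & (qdim p <= 2 * n)%N.
Proof.
move=> c2 s0 iso [hH hq].
have c2L : 2%N \in [pchar L] := rmorph_pchar j c2.
have dp : (2 <= qdim p)%N.
  by rewrite (isometric_dim iso) qdim_pfister; have := expn_gt0 2 (size s); lia.
have [isoH|nH] := pselect (isometric p (qbin 0 0)).
  exists 1%N; last by rewrite (isometric_dim isoH).
  apply: isotropic_rank_map; apply: isotropic_rank_isometric (isometric_sym isoH) _.
  exists 1%N, (row_mx 1%:M 0%:M); split.
    rewrite rank_rV; suff -> : row_mx 1%:M 0%:M != 0 :> 'rV[K]_(1 + 1) by [].
    by rewrite -row_mx0; apply/eqP => /eq_row_mx[/matrixP/(_ 0 0)/eqP]; rewrite !mxE oner_eq0.
  by move=> z; rewrite [z]mx11_scalar mul_scalar_mx qvZ qv_qbin !mulr0 !addr0 mulr0.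
have [x [genx _]] := hq nH.
have isoL := isometric_qext j iso; rewrite qext_pfister in isoL.
have s0L : 0 \notin map j s.
  by apply/mapP => -[c cs /esym/eqP]; rewrite fmorph_eq0 => /eqP c0; rewrite c0 (negPf s0) in cs.
have [_ hyp _] := pfister_round c2L (j a) s0L.
pose e : 'rV[L]_(qdim p) := \row_k x k.
have [||n rn dn] := isotropic_hyperbolic_isometric (isometric_sym isoL) hyp (e := e).
- apply/eqP => ez.
  pose k0 : 'I_(qdim p) := Ordinal (leq_trans (ltnSn 0) (ltnW dp)).
  have [+ _] := genx 1%N 'X_k0 (mpolyX_homog K k0).
  rewrite meval_map_mpoly mmapXi => /(_ _)[|g].
    by move/rowP/(_ k0): ez; rewrite !mxE.
  (* If all coordinates vanished, a variable would be a multiple of the quadric; setting all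
     variables equal to [X] would make [X] a multiple of [X^2]. *)
  move/(congr1 (mmap (@polyC K) (fun=> 'X))).
  rewrite rmorphM /= mmapXi quadric_poly_qv -(qv_map (mmap _ _)) -map_mx_comp.
  have -> : map_mx (mmap (@polyC K) (fun=> 'X)) (\row_i 'X_i) = 'X *: const_mx 1 :> 'rV_(qdim p).
    by apply/rowP=> k; rewrite !mxE mmapXi mulr1.
  rewrite qvZ mulrCA mulrC => /polyP/(_ 1%N)/eqP.
  by rewrite coefMXn coefX /= oner_eq0.
- have : (map_mpoly j (quadric_poly p)).@[x] = 0.
    by apply/(genx 2%N (quadric_poly p) (quadric_poly_homog p)); exists 1; rewrite mul1r.
  rewrite meval_map_mpoly quadric_poly_qv -(qv_map (mmap j x)) -map_mx_comp => <-.
  have -> : map_mx (mmap j x) (\row_i 'X_i) = e by apply/rowP=> k; rewrite !mxE mmapXi.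
  by congr (qv _ _); apply/matrixP=> k l; rewrite !mxE /= mmapC.
by exists n.
Qed.

Theorem corollary4p3 (F K L : fieldType)
    (i : {rmorphism F -> K}) (j : {rmorphism K -> L})
    (n : nat) (p : nsqform F) :
  2%N \in [pchar F] ->
  (0 < n)%N ->
  is_pfister n p ->
  (forall x : K, exists a : F, i a = x ^+ 2) ->
  is_function_field j (qext i p) ->
  Wq_ker (j \o i)%FUN = [set v + w | v in Wq_ker i & w in W_tens p].
Proof.
move=> c2 _ [s [a [_ s0 iso]]] sqF hff.
have c2K : 2%N \in [pchar K] := rmorph_pchar i c2.
have isoK := isometric_qext i iso; rewrite qext_pfister in isoK.
have s0K : 0 \notin map i s.
  by apply/mapP => -[c cs /esym/eqP]; rewrite fmorph_eq0 => /eqP c0; rewrite c0 (negPf s0) in cs.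
have nsp : nonsingular p := @nonsingular_nsval F p.
have dp : (2 <= qdim p)%N.
  by rewrite (isometric_dim iso) qdim_pfister; have := expn_gt0 2 (size s); lia.
have [np rp dnp] := function_field_hyperbolic c2K s0K isoK hff.
have kerK v : wext i v = 0 -> wext (j \o i)%FUN v = 0.
  elim/wclass_ind: v => q /wext0P h; apply/wext0P; rewrite qext_comp.
  by have := witt_equiv_qext j h; rewrite -[qzero K]/(hyp K 0) qext_hyp.
have kerW w : W_tens p w -> wext (j \o i)%FUN w = 0.
  move=> [m [b [sb [ub ->]]]]; apply/wext0P; rewrite qext_comp.
  have -> : qext j (qext i (nstens sb ub p)) = qtens (map_mx j (map_mx i b)) (qext j (qext i p)).
    by rewrite /qext /= !map_mxT.
  apply: (@isotropic_rank_witt0 _ (rmorph_pchar j c2K) _ (m * np)).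
  - apply: nonsingular_tens; first by rewrite !map_trmx sb.
      by rewrite !map_unitmx.
    by do 2!apply: nonsingular_ext.
  - by apply: isotropic_rank_tens => //; rewrite !map_trmx sb.
  - by rewrite [X in (X <= _)%N](_ : _ = (m * qdim p)%N) // mulnCA leq_mul2l dnp orbT.
apply/seteqP; split=> [w|_ [v hv [w hw] <-]]; last first.
  by rewrite /Wq_ker /= raddfD /= (kerK v hv) (kerW w hw) addr0.
elim/wclass_ind: w => q hq.
(* In the hyperbolic plane case L is K by convention, so the class already dies over K. *)
have [isoH|nH] := pselect (isometric (qext i p) (qbin 0 0)).
  exists (wclass q); last by exists 0; rewrite ?addr0 //; apply: W_tens0.
  apply/wext0P; have /wext0P := hq; rewrite qext_comp => /witt0_isotropic_rank[k rk dk].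
  apply: (isotropic_rank_witt0 c2K (n := k)) => //;
    first exact: nonsingular_ext (@nonsingular_nsval F q).
  by apply: isotropic_rank_bij rk; apply: hff.1.
have hquad := hff.2 nH.
have [e pe] : exists e, qv (qmx (qext i p)) e = 1.
  have [e he] := pfister_unit (map i s) (i a).
  have /isometric_mxP[S [T [ST TS h]]] := isometric_sym isoK.
  by exists (e *m S); rewrite h.
have [N] := ubnP (qdim q); elim: N q hq => // N IH q hq dq.
(* Since [q1] and [q2] differ by an element of the kernel, it suffices to treat [q2]. *)
have reduce (q1 q2 : nsqform F) : (qdim q2 < N)%N -> wext (j \o i)%FUN (wclass q1) = 0 ->
    witt_equiv (qext i q1) (qext i q2) ->
    [set v + w | v in Wq_ker i & w in W_tens p] (wclass q1).
  move=> d2 h1 h12.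
  have e12 : wext i (wclass q1) = wext i (wclass q2) by rewrite !wext_class; apply/wclassP.
  have h2 : wext (j \o i)%FUN (wclass q2) = 0.
    move/wext0P: h1 => h1; apply/wext0P; rewrite !qext_comp in h1 *.
    by apply: witt_equiv_trans h1; apply: witt_equiv_qext; apply: witt_equiv_sym.
  have [v hv [w hw vw]] := IH q2 h2 d2.
  exists (wclass q1 + wclass q2 + v).
    by rewrite /Wq_ker /= !raddfD /= e12 (wq_addvv c2K) add0r; apply: hv.
  by exists w => //; rewrite -addrA vw -addrA (wq_addvv c2) addr0.
have nsq := @nonsingular_nsval F q.
have [[v v0 qv0]|an] := pselect (exists2 v : 'rV[K]_(qdim q), v != 0 & qv (qmx (qext i q)) v = 0).
  have rq : isotropic_rank (qext i q) 1.
    exists 1%N, v; split; first by rewrite rank_rV v0.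
    by move=> z; rewrite [z]mx11_scalar mul_scalar_mx qvZ qv0 mulr0.
  have [q' [ns' d' w']] := witt_descent c2 sqF nsq rq.
  by apply: (reduce q (NSQForm (asboolT ns'))) => //=; move: dq; rewrite d'; lia.
have {}an : anisotropic (qmx (qext i q)).
  by move=> v qv0; apply/eqP; apply: contrapT => /negP v0; apply: an; exists v.
have [d0|d0] := posnP (qdim q).
  exists 0; first by rewrite /Wq_ker /= raddf0.
  exists 0; first exact: W_tens0.
  rewrite addr0 -wclass0; apply/wclassP/witt_equiv_sym.
  by apply: (isotropic_rank_witt0 c2 (n := 0)); rewrite ?d0 //; exists 0%N, 0; split=> // z;
    rewrite mulmx0 qv0.
(* Any nonzero vector over F would do; its value is nonzero by anisotropy over K. *)
pose f : 'rV[F]_(qdim q) := delta_mx 0 (Ordinal d0); set d := qv (qmx q) f.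
have dn0 : d != 0.
  apply/eqP => dz; have : map_mx i f = 0 by apply: an; rewrite qv_map -/d dz rmorph0.
  by move/rowP/(_ (Ordinal d0))/eqP; rewrite !mxE !eqxx rmorph1 oner_eq0.
have /wext0P := hq; rewrite qext_comp => /witt0_isotropic_rank[k rk dk].
have [P hP] := function_field_subform c2K (nonsingular_ext nsp) pe nH hquad an rk dk (map_mx i f).
have [r [rW risO]] := W_tens_scale p dn0.
pose q1 := nssum q r.
(* On the graph of the embedding the two summands both take the value [d p(z)] and cancel. The
   identity block gives the rank. *)
have rq1 : isotropic_rank (qext i q1) (qdim p).
  have iso1 := isometric_qext i (isometric_osum (isometric_refl q) (isometric_sym risO)).
  apply: isotropic_rank_isometric iso1 _; rewrite qext_osum.
  exists (qdim p), (row_mx P 1%:M); split.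
    have h : row_mx P 1%:M *m col_mx 0 1%:M = 1%:M :> 'M_(qdim p).
      by rewrite mul_row_col mulmx0 add0r mulmx1.
    by apply: leq_trans (mxrankM_maxl _ (col_mx 0 1%:M)); rewrite h mxrank1.
  move=> z; rewrite mul_mx_row mulmx1 [LHS]qv_block_diag hP qv_map /= map_mxZ qvZm.
  by rewrite addrr_pchar2.
have [q2 [ns2 d2 w2]] := witt_descent c2 sqF (@nonsingular_nsval F q1) rq1.
have hq1 : wext (j \o i)%FUN (wclass q1) = 0.
  by rewrite /q1 wclassD raddfD /= hq (kerW _ rW) addr0.
(* The dimension of [q2] is [dim q - dim p], strictly smaller since [dim p >= 2]. *)
have [|v hv [w hw vw]] := reduce q1 (NSQForm (asboolT ns2)) _ hq1 w2.
  by rewrite /=; move: dq d2; rewrite -[qdim q1]/(qdim q + qdim r)%N (isometric_dim risO) /=; lia.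
exists v => //; exists (w + wclass r); first exact: W_tensD.
by rewrite addrA vw /q1 wclassD -addrA (wq_addvv c2) addr0.
Qed.
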